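(* Let $N$ be an invariant subspace of $X=S_E\oplus S_F^*$ on $H_E^2\oplus H_F^2$. Then there exists an invariant subspace $N_3$ of $M_z\oplus M_z$ on $L_E^2\oplus L_F^2$ such that $$N=J_2\left[(L_E^2\oplus H_F^2)\ominus N_3\right]=(L_E^2\oplus H_F^2)\ominus J_2N_3,$$ where $$zH_E^2\subset N_3\subset L_E^2\oplus H_F^2.\qquad( * )$$ Conversely, if $N_3$ is an invariant subspace of $M_z\oplus M_z$ on $L_E^2\oplus L_F^2$ such that $( * )$ holds, then $J_2\left[(L_E^2\oplus H_F^2)\ominus N_3\right]$ is an invariant subspace of $X$.
   Context: $E$ and $F$ are complex separable Hilbert spaces. $L_E^2$ is the space of square integrable $E$-valued functions on the unit circle $\mathbb T$ (normalized Lebesgue measure) and $H_E^2\subset L_E^2$ the $E$-valued Hardy space. $S_E$ is the shift (multiplication by $z$) on $H_E^2$, and $M_z$ is multiplication by $z$ (bilateral shift) on $L_E^2$ or $L_F^2$. Invariant subspaces are closed. $zH_E^2$ is regarded as the subspace $zH_E^2\oplus\{0\}$ of $L_E^2\oplus L_F^2$. $J_1:L_E^2\to L_E^2$ is the unitary operator $J_1f(z)=f(\overline z)$, and $$J_2=\begin{bmatrix}J_1&0\\0&I\end{bmatrix}:L_E^2\oplus H_F^2\to L_E^2\oplus H_F^2 .$$ *)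

(* Defs.v *)
From HB Require Import structures.
From mathcomp Require Import all_boot all_order all_algebra.
From mathcomp Require Import sesquilinear.
From mathcomp Require Import all_classical all_reals all_analysis.
From mathcomp Require Import measurable_realfun complex.

Set Implicit Arguments.
Unset Strict Implicit.
Unset Printing Implicit Defensive.

Import Order.TTheory GRing.Theory Num.Theory.
Import numFieldNormedType.Exports.

Local Open Scope classical_set_scope.
Local Open Scope ring_scope.
Local Open Scope complex_scope.

(* The inner product [hdot] is linear in its first argument and
   conjugate-linear in the second one. *)
HB.mixin Record CompleteNormedModule_isHilbert (R : realType) (E : Type)
    & CompleteNormedModule R[i] E := {
  hdot : {dot E for @Num.conj R[i]} ;
  hnormE : forall x : E, `|x| ^+ 2 = hdot x x
}.

#[short(type="hilbertType")]
HB.structure Definition Hilbert (R : realType) :=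
  {E of CompleteNormedModule R[i] E & CompleteNormedModule_isHilbert R E}.

Definition separable (T : topologicalType) :=
  exists2 D : set T, countable D & dense D.

Section circle.
Variable R : realType.

Record circle := Circle { cval :> R[i]; cvalP : `|cval| == 1 }.

HB.instance Definition _ := [isSub for cval].
HB.instance Definition _ := [Choice of circle by <:].

Lemma norm1_circle : `|1 : R[i]| == 1. Proof. by rewrite normr1. Qed.

HB.instance Definition _ := isPointed.Build circle (Circle norm1_circle).

Lemma norm_conj_circle (z : circle) : `|(cval z)^*| == 1.
Proof. by case: z => -[a b] /=; rewrite !normc_def /= sqrrN. Qed.

Definition circle_conj (z : circle) : circle := Circle (norm_conj_circle z).

Definition circle_open : set (set circle) :=
  [set cval @^-1` U | U in @open (R[i]^o)].

HB.instance Definition _ := @isMeasurable.Build (sigma_display circle_open)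
  circle <<s circle_open>> (@sigma_algebra0 _ setT circle_open)
  (@sigma_algebraC _ circle_open) (@sigma_algebra_bigcup _ setT circle_open).

Lemma norm_expi (t : R) : `|cos t +i* sin t| == 1.
Proof. by rewrite normc_def /= cos2Dsin2 sqrtr1. Qed.

Definition expi (t : measurableTypeR R) : circle := Circle (norm_expi t).

Lemma continuous_real_complex :
  continuous (fun x : R => x%:C%C : R[i]^o).
Proof.
move=> x; apply/cvgrPdist_lt => -[e e'] /=; rewrite ltcE /= => /andP[/eqP -> e0].
near=> y; rewrite -rmorphB normc_def /= expr0n /= addr0 sqrtr_sqr.
rewrite ltcR; near: y.
by move: e e0; apply/cvgrPdist_lt; exact: cvg_id.
Unshelve. all: by end_near. Qed.

Lemma continuous_expi : continuous (fun t : R => cval (expi t) : R[i]^o).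
Proof.
move=> t; rewrite /expi /=.
rewrite [X in continuous_at _ X](_ : _ = fun s : R =>
   ((cos s)%:C%C : R[i]^o) + ('i%C : R[i]) *: ((sin s)%:C%C : R[i]^o));
  last by apply/funext => s; rewrite [LHS]complexE.
apply: cvgD; last apply: cvgZr.
- apply: continuous_comp; first exact: continuous_cos.
  exact: continuous_real_complex.
- apply: continuous_comp; first exact: continuous_sin.
  exact: continuous_real_complex.
Qed.

Lemma measurable_expi : measurable_fun setT expi.
Proof.
apply: (@measurability _ _ _ _ _ _ circle_open) => //.
move=> _ [_ [U oU <-] <-]; rewrite setTI; apply: open_measurable.
exact: (@open_comp _ (R[i]^o) (fun t => cval (expi t)) U
  (fun t _ => @continuous_expi t) oU).
Qed.

HB.instance Definition _ :=
  isMeasurableFun.Build _ _ _ _ expi measurable_expi.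

Lemma twopi_gt0 : (0 : R) < 2 * pi.
Proof. by rewrite mulr_gt0// pi_gt0. Qed.

(* The normalized Lebesgue measure on the circle. *)
Definition circle_prob : probability circle R :=
  distribution (uniform_prob twopi_gt0) expi.

Definition cintegral (f : circle -> R[i]) : R[i] :=
  (\int[circle_prob]_z complex.Re (f z)) +i*
  (\int[circle_prob]_z complex.Im (f z)).

End circle.

Section L2.
Variables (R : realType) (E : hilbertType R).
Implicit Types f g : circle R -> E.

Local Notation m := (@circle_prob R).

(* The elements of [L2] are functions, not classes of functions modulo equality
   almost everywhere.  A subspace that is closed for the L2 seminorm, as
   required by [is_closed_subspace] below, is saturated for this relation, so
   it is the same thing as a closed subspace of the quotient. *)
Definition L2 : set (circle R -> E) := [set f |
  measurable_fun setT (f : circle R -> g_sigma_algebraType (@open E)) /\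
  (\int[m]_z (complex.Re (`|f z| ^+ 2))%:E < +oo)%E].

Definition L2dot f g : R[i] := cintegral (fun z => hdot (f z) (g z)).

(* [v] is the Fourier coefficient \int f(z) z^(-n) dm(z), as a weak integral. *)
Definition is_fourier_coef f (n : int) (v : E) := forall e : E,
  hdot v e = cintegral (fun z => cval z ^ (- n) * hdot (f z) e).

Definition hardy : set (circle R -> E) := [set f |
  L2 f /\ forall n : int, n < 0 -> is_fourier_coef f n 0].

Definition zshift f : circle R -> E := fun z => cval z *: f z.

Definition J1 f : circle R -> E := fun z => f (circle_conj z).

(* The Hilbert space adjoint of the operator [T] on the closed subspace [H]: its
   value at [g] is determined up to equality almost everywhere, and [xget]
   selects a representative. *)
Definition adjoint_on (H : set (circle R -> E))
    (T : (circle R -> E) -> circle R -> E) (g : circle R -> E) : circle R -> E :=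
  xget 0 [set h | H h /\ forall f, H f -> L2dot (T f) g = L2dot f h].

End L2.

Section direct_sum.
Variables (R : realType) (E F : hilbertType R).

Local Notation V := ((circle R -> E) * (circle R -> F))%type.
Implicit Types (p q : V) (H M N : set V) (T : V -> V).

Definition sumdot p q : R[i] := L2dot p.1 q.1 + L2dot p.2 q.2.

Definition sumnorm p : R := Num.sqrt (complex.Re (sumdot p p)).

Definition is_closed_subspace H N :=
  [/\ N `<=` H,
      N 0,
      forall (a : R[i]) p q, N p -> N q -> N (a *: p + q) &
      forall (u : nat -> V) p, (forall n, N (u n)) -> H p ->
        (fun n => sumnorm (u n - p)) @ \oo --> (0 : R) -> N p].

Definition invariant_subspace H T N :=
  is_closed_subspace H N /\ forall p, N p -> N (T p).

Definition ominus H M : set V := [set p | H p /\ forall q, M q -> sumdot p q = 0].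

Definition opsum (A : (circle R -> E) -> circle R -> E)
    (B : (circle R -> F) -> circle R -> F) : V -> V :=
  fun p => (A p.1, B p.2).

Definition J2 : V -> V := opsum (@J1 R E) id.

End direct_sum.

(* Main.v *)
(* The shift part of [X] is turned into a compression of [M_z] by the
   reflection [J1]: since [J1 (z f) = z^-1 (J1 f)], one has
   <(M_z (+) M_z) p, J2 q> = <p, J2 (X q)> for p in L2E (+) H2F and q in
   H2E (+) H2F.  Hence N3 = (L2E (+) H2F) (-) J2 N is invariant under
   M_z (+) M_z as soon as N is invariant under X, and conversely.  That N is
   recovered from N3 is the projection theorem for closed subspaces, hence the
   completeness of L2 (Riesz-Fischer).  The inclusion z H2E <= N3 says that
   z H2E is orthogonal to J1 H2E, which follows from the totality of the
   functions z^n e in L2E: the bounded real functions whose product with every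
   h orthogonal to all z^n e is again orthogonal to all z^n e form an algebra
   closed under bounded pointwise limits and containing Re z and Im z, hence all
   Borel indicators, so that such an h vanishes almost everywhere. *)
Require Import Defs.
From HB Require Import structures.
From mathcomp Require Import all_boot all_order all_algebra.
From mathcomp Require Import sesquilinear.
From mathcomp Require Import all_classical all_reals all_analysis.
From mathcomp Require Import measurable_realfun complex.
From mathcomp Require Import ring lra zify.

Set Implicit Arguments.
Unset Strict Implicit.
Unset Printing Implicit Defensive.

Import Order.TTheory GRing.Theory Num.Theory.
Import numFieldNormedType.Exports.

Local Open Scope classical_set_scope.
Local Open Scope ring_scope.
Local Open Scope complex_scope.

(** * The real inner product of a complex Hilbert space *)

(** Elements of [L2] are functions, so [L2] is only a seminormed space, and the projection theorem
    is proved directly for the seminorm [nrm2]. It is proved once, for pairs; a use that concerns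
    one component puts 0 in the other. Complex inner products are handled through real parts: since
    Im <x, y> = Re <x, iy>, a complex orthogonality relation is a real one tested at y and at iy.
    Separability acts through the formula |x|^2 = sup_n (2 Re <x, d_n> - |d_n|^2) for a dense
    sequence d. It gives measurability of norms, and at the end it reduces the almost everywhere
    vanishing of h to countably many scalar statements. Closedness of the Hardy spaces is not
    checked on Fourier coefficients of limits: they are orthogonal complements of monomials, and
    every orthogonal complement is closed. Equalities between sets of functions hold exactly,
    because a closed subspace absorbs changes on null sets. *)

Section real_inner_product.
Variables (R : realType) (E : hilbertType R).
Implicit Types (x y u v : E) (a : R[i]).

Definition rdot x y : R := complex.Re (hdot x y).
Definition sqn x : R := complex.Re (`|x| ^+ 2).

Lemma sqnE x : sqn x = rdot x x.
Proof. by rewrite /sqn hnormE. Qed.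

Lemma Re_conj a : complex.Re (Num.conj a) = complex.Re a.
Proof. by case: a. Qed.

Lemma Im_conj a : complex.Im (Num.conj a) = - complex.Im a.
Proof. by case: a. Qed.

Lemma hdotC x y : hdot x y = Num.conj (hdot y x).
Proof. by rewrite hermC /= expr0 mul1r. Qed.

Lemma rdotC x y : rdot x y = rdot y x.
Proof. by rewrite /rdot hdotC Re_conj. Qed.

Lemma rdotDl x y z : rdot (x + y) z = rdot x z + rdot y z.
Proof. by rewrite /rdot linearDl raddfD. Qed.

Lemma rdotNl x z : rdot (- x) z = - rdot x z.
Proof. by rewrite /rdot linearNl raddfN. Qed.

Lemma rdotBl x y z : rdot (x - y) z = rdot x z - rdot y z.
Proof. by rewrite rdotDl rdotNl. Qed.

Lemma rdotDr x y z : rdot z (x + y) = rdot z x + rdot z y.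
Proof. by rewrite rdotC rdotDl !(rdotC z). Qed.

Lemma rdotNr x z : rdot z (- x) = - rdot z x.
Proof. by rewrite rdotC rdotNl rdotC. Qed.

Lemma rdotBr x y z : rdot z (x - y) = rdot z x - rdot z y.
Proof. by rewrite rdotDr rdotNr. Qed.

Lemma rdot0l z : rdot 0 z = 0.
Proof. by rewrite /rdot linear0l. Qed.

Lemma rdotZl a x z :
  rdot (a *: x) z = complex.Re a * rdot x z - complex.Im a * complex.Im (hdot x
    z).
Proof. by rewrite /rdot linearZl_LR /=; case: a (hdot x z) => [? ?] [? ?]. Qed.

(** Conjugate-linearity in the second slot gives <x, iy> = -i <x, y>. Measurability and
    integrability of [hdot] thus reduce to those of [rdot]. *)
Lemma Im_hdot x y : complex.Im (hdot x y) = rdot x ('i%C *: y).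
Proof.
rewrite rdotC rdotZl/= mul0r sub0r mul1r.
by rewrite hdotC Im_conj.
Qed.

Lemma rdotZRl (t : R) x z : rdot (t%:C%C *: x) z = t * rdot x z.
Proof. by rewrite rdotZl /= mul0r subr0. Qed.

Lemma rdotZRr (t : R) x z : rdot z (t%:C%C *: x) = t * rdot z x.
Proof. by rewrite rdotC rdotZRl rdotC. Qed.

Lemma rdot_ge0 x : 0 <= rdot x x.
Proof. by have := dnorm_ge0 hdot x; rewrite lecE => /andP[]. Qed.

Lemma rdot_eq0 x : rdot x x = 0 -> x = 0.
Proof.
move=> x0; apply/eqP; rewrite -(dnorm_eq0 hdot); apply/eqP.
have := dnorm_ge0 hdot x; rewrite lecE /= => /andP[/eqP + _].
by move: x0; rewrite /rdot; case: (hdot x x) => a b /= -> ->.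
Qed.

Lemma Re_norm x : 0 <= complex.Re `|x|.
Proof. by have := normr_ge0 x; rewrite lecE => /andP[]. Qed.

Lemma norm_ReE x : `|x| = (complex.Re `|x|)%:C%C.
Proof. by rewrite RRe_real// normr_real. Qed.

Lemma Re_norm2 x : (complex.Re `|x|) ^+ 2 = rdot x x.
Proof. by rewrite -sqnE /sqn norm_ReE -rmorphXn/=. Qed.

Lemma norm_lt x (e : R) : 0 < e -> (`|x| < e%:C%C) = (rdot x x < e ^+ 2).
Proof.
move=> e0; rewrite norm_ReE ltcR -Re_norm2 ltr_pXn2r//;
  last by rewrite nnegrE ltW.
by rewrite nnegrE Re_norm.
Qed.

Lemma rdot_amgm x y : `|rdot x y| <= (rdot x x + rdot y y) / 2.
Proof.
have := rdot_ge0 (x + y); have := rdot_ge0 (x - y).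
rewrite !rdotDl !rdotDr !rdotNl !rdotNr (rdotC y x) => h1 h2.
by rewrite ler_norml; apply/andP; split; lra.
Qed.

Lemma rdot_cs x y : rdot x y ^+ 2 <= rdot x x * rdot y y.
Proof.
have [y0|y0] := eqVneq (rdot y y) 0.
  by rewrite (rdot_eq0 y0) rdotC !rdot0l expr0n mulr0.
have yp : 0 < rdot y y by rewrite lt_def y0 rdot_ge0.
(* Up to the factor [rdot y y], this vector is the component of [x] orthogonal to [y] for the real
   inner product; its square norm is [t * (s * t - w ^+ 2)]. *)
have := rdot_ge0 ((rdot y y)%:C%C *: x - (rdot x y)%:C%C *: y).
rewrite !rdotBl !rdotBr !rdotZRl !rdotZRr (rdotC y x).
set s := rdot x x; set t := rdot y y; set w := rdot x y => h.
have : 0 <= t * (s * t - w ^+ 2) by apply: le_trans h _; rewrite le_eqVlt;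
  apply/orP; left; apply/eqP; ring.
by rewrite pmulr_rge0// subr_ge0.
Qed.

Lemma rdotDD_le x y : rdot (x + y) (x + y) <= 2 * rdot x x + 2 * rdot y y.
Proof.
have := rdot_ge0 (x - y).
rewrite !rdotDl !rdotDr !rdotNl !rdotNr (rdotC y x) => h1; lra.
Qed.

Lemma hdotZl a x y : hdot (a *: x) y = a * hdot x y.
Proof. by rewrite linearZl_LR. Qed.

Lemma hdotZr a x y : hdot x (a *: y) = Num.conj a * hdot x y.
Proof. by rewrite linearZr_LR. Qed.

End real_inner_product.

(** * Measurability of Hilbert space valued functions *)

Section real_valued.
Context d (T : measurableType d) (R : realType).
Implicit Types f g : T -> R.

Lemma measurable_fun_gtP f :
  (forall a, measurable [set z | a < f z]) -> measurable_fun setT f.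
Proof.
move=> mf; apply: (measurability _ (RGenOInfty.measurableE R)).
move=> _ [_ [a ->] <-]; rewrite setTI.
rewrite (_ : _ @^-1` _ = [set z | a < f z])//.
by apply/seteqP; split=> z /=; rewrite in_itv /= andbT.
Qed.

Lemma measurable_le_set f g : measurable_fun setT f -> measurable_fun setT g ->
  measurable [set z | f z <= g z].
Proof.
move=> mf mg; have := measurable_fun_ler mf mg measurableT.
move=> /(_ [set true] I); rewrite setTI.
by rewrite (_ : _ @^-1` _ = [set z | f z <= g z])//; apply/seteqP; split.
Qed.

Lemma measurable_lt_set f g : measurable_fun setT f -> measurable_fun setT g ->
  measurable [set z | f z < g z].
Proof.
move=> mf mg; rewrite (_ : mkset _ = ~` [set z | g z <= f z]).
  exact/measurableC/measurable_le_set.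
by apply/seteqP; split=> z /=; rewrite ltNge => /negP.
Qed.

Lemma measurable_fun_leP f :
  (forall a, measurable [set z | f z <= a]) -> measurable_fun setT f.
Proof.
move=> mf; apply: measurable_fun_gtP => a.
rewrite (_ : mkset _ = ~` [set z | f z <= a]); first exact: measurableC.
by apply/seteqP; split=> z /=; rewrite ltNge => /negP.
Qed.

End real_valued.

Section measurability.
Variables (R : realType) (E : hilbertType R).
Implicit Types (x y : E).

Definition approx_seq (d : nat -> E) :=
  forall x (e : R), 0 < e -> exists n, rdot (x - d n) (x - d n) < e.

Lemma ball_hilbertE x y (e : R) : 0 < e ->
  ball x e%:C%C y = (rdot (x - y) (x - y) < e ^+ 2) :> Prop.
Proof. by move=> e0; rewrite -ball_normE /ball_ /= norm_lt. Qed.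

Lemma separable_approx_seq : separable E -> exists d, approx_seq d.
Proof.
case=> D cD dD.
have D0 : D !=set0.
  by have [|//|y [_ Dy]] := dD setT; [exists 0|exact: openT|exists y].
have [f fD] : exists f : nat -> E, forall y, D y -> exists n, f n = y.
  have /pcard_leP[f] := cD.
  have [y0 Dy0] := D0.
  (* Countability yields an injection [f] of [D] into [nat]; its partial inverse enumerates [D],
     with the dummy value [y0] at the other indices. *)
  exists (fun n => xget y0 [set y | D y /\ f y = n]) => y Dy.
  exists (f y); case: xgetP => [z _ [Dz fz]|/(_ y)[]//].
  by apply: (@inj _ _ _ f); rewrite ?inE.
exists f => x e e0.
have se0 : 0 < Num.sqrt e by rewrite sqrtr_gt0.
have [||y [/= xy Dy]] := dD ((ball x (Num.sqrt e)%:C%C)^°).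
- by exists x; apply: nbhsx_ballx; rewrite ltcR.
- exact: open_interior.
have [n fn] := fD _ Dy; exists n; rewrite fn.
move: xy => /interior_subset; rewrite ball_hilbertE// sqr_sqrtr//.
exact: ltW.
Qed.

Variable d : nat -> E.
Hypothesis dP : approx_seq d.

(** Completing the square, the n-th expression is |x|^2 - |x - d n|^2: never above |x|^2, and
    arbitrarily close to it by density. *)
Lemma rdot_leP x c :
  rdot x x <= c <-> forall n, 2 * rdot x (d n) - rdot (d n) (d n) <= c.
Proof.
split=> [xc n|h].
  have := rdot_ge0 (x - d n); rewrite rdotBl !rdotBr (rdotC (d n) x) => ?; lra.
apply/ler_addgt0Pr => e e0.
have [n] := dP x e0; have := h n.
rewrite rdotBl !rdotBr (rdotC (d n) x) => ? ?; lra.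
Qed.

(** Second countability: measurability of a map into [E] need only be tested on balls centred at the
    [d n]. *)
Lemma open_bigcup_balls (U : set E) : open U ->
  U = \bigcup_(p in [set p : nat * nat | forall y,
        rdot (y - d p.1) (y - d p.1) < p.2.+1%:R^-1 ^+ 2 -> U y])
      [set y | rdot (y - d p.1) (y - d p.1) < p.2.+1%:R^-1 ^+ 2].
Proof.
move=> oU; apply/seteqP; split=> [x Ux|x [p /= + ?]]; last exact.
have /nbhs_ballP[[e e'] /=] : nbhs x U by exact: open_nbhs_nbhs.
rewrite ltcE /= => /andP[/eqP-> e0] xeU.
(* With a radius r < e / 2 and a centre within r of both [x] and [y], |x - y|^2 <= 2 r^2 + 2 r^2 <
   e^2. *)
have e20 : 0 < e / 2 by rewrite divr_gt0.
have [n] := ltr_add_invr e20; rewrite add0r => ne.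
have n0 : (0 : R) < n.+1%:R^-1 ^+ 2 by rewrite exprn_gt0.
have [k xk] := dP x n0.
exists (k, n) => //= y /= yk; apply: xeU.
rewrite ball_hilbertE// (_ : x - y = (x - d k) - (y - d k)); last first.
  by rewrite opprB addrA subrK.
apply: le_lt_trans (rdotDD_le _ _) _; rewrite rdotNl rdotNr opprK.
have : n.+1%:R^-1 ^+ 2 < (e / 2) ^+ 2 by rewrite ltr_pXn2r ?nnegrE// ltW.
move: xk yk => /=; move: (_ ^+ 2) => w xk yk; nra.
Qed.

Local Notation borel := (g_sigma_algebraType (@open E)).

Lemma open_rdot_gt y (a : R) : open [set x : E | a < rdot x y].
Proof.
rewrite openE => x /= ax; apply/nbhs_ballP.
pose b := rdot x y - a; have b0 : 0 < b by rewrite subr_gt0.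
(* Adding 1 makes [c] positive even when [y] is 0 and gives |y|^2 <= c^2, so by Cauchy-Schwarz
   [rdot _ y] moves by less than [b] on the ball of radius [b / c]. *)
pose c := rdot y y + 1; have c0 : 0 < c by rewrite ltr_wpDl// rdot_ge0.
exists (b / c)%:C%C => /=; first by rewrite ltcR divr_gt0.
move=> z; rewrite ball_hilbertE ?divr_gt0// => xz.
have : rdot (x - z) y ^+ 2 < b ^+ 2.
  apply: (le_lt_trans (rdot_cs _ _)).
  apply: (@le_lt_trans _ _ (rdot (x - z) (x - z) * c ^+ 2)).
    rewrite ler_wpM2l ?rdot_ge0// /c; have := rdot_ge0 y; nra.
  by rewrite -ltr_pdivlMr ?exprn_gt0// -expr_div_n.
rewrite -subr_gt0 subr_sqr => xz2.
rewrite /=  (_ : rdot z y = rdot x y - rdot (x - z) y); last by rewrite rdotBl;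
  ring.
rewrite -subr_gt0; set r := rdot (x - z) y in xz2 *.
have -> : rdot x y - r - a = b - r by rewrite /b; ring.
by nra.
Qed.

Context disp (T : measurableType disp).
Implicit Types f g : T -> E.

Lemma measurable_rdot_fun f : measurable_fun setT (f : T -> borel) ->
  forall e, measurable_fun setT (fun z => rdot (f z) e).
Proof.
move=> mf e; apply: measurable_fun_gtP => a.
rewrite (_ : mkset _ = setT `&` f @^-1` [set x | a < rdot x e]);
  last by rewrite setTI.
by apply: mf => //; apply: sub_sigma_algebra; exact: open_rdot_gt.
Qed.

Lemma weak_measurable_sqn f :
  (forall e, measurable_fun setT (fun z => rdot (f z) e)) ->
  measurable_fun setT (fun z => rdot (f z) (f z)).
Proof.
move=> mf; apply: measurable_fun_leP => a.
rewrite (_ : mkset _ = \bigcap_n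
    [set z | 2 * rdot (f z) (d n) - rdot (d n) (d n) <= a]).
  apply: bigcapT_measurable => n; apply: measurable_le_set => //.
  apply: measurable_funB => //; apply: measurable_funM => //; exact: mf.
apply/seteqP; split=> z /=.
  by move=> /rdot_leP h n _; exact: h.
by move=> h; apply/rdot_leP => n; exact: h.
Qed.

(* Pettis: [rdot x x] is the supremum of [2 * rdot x (d n) - rdot (d n) (d n)],
   so the norm of a weakly measurable function is measurable. *)
Lemma weak_measurable f :
  (forall e, measurable_fun setT (fun z => rdot (f z) e)) ->
  measurable_fun setT (f : T -> borel).
Proof.
move=> mf; apply: (@measurability _ _ _ borel _ _ (@open E)) => //.
move=> _ [U oU <-]; rewrite setTI (open_bigcup_balls oU).
rewrite preimage_bigcup bigcup_mkcond.
apply: countable_bigcupT_measurable => // p; case: ifP => // _.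
apply: measurable_lt_set => //; apply: weak_measurable_sqn => e.
rewrite (_ : (fun z => _) = (fun z => rdot (f z) e - rdot (d p.1) e)).
  exact: measurable_funB.
by apply/funext => z; rewrite rdotBl.
Qed.

Lemma weak_measurable_rdot f g :
  (forall e, measurable_fun setT (fun z => rdot (f z) e)) ->
  (forall e, measurable_fun setT (fun z => rdot (g z) e)) ->
  measurable_fun setT (fun z => rdot (f z) (g z)).
Proof.
move=> mf mg.
rewrite (_ : (fun z => _) = (fun z => 4^-1 * (rdot (f z + g z) (f z + g z) -
  rdot (f z - g z) (f z - g z)))).
  apply: measurable_funM => //; apply: measurable_funB;
    apply: weak_measurable_sqn => e.
    under eq_fun do rewrite rdotDl; exact: measurable_funD.
  under eq_fun do rewrite rdotBl; exact: measurable_funB.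
apply/funext => z; rewrite !rdotDl !rdotDr !rdotNl !rdotNr (rdotC (g z)); lra.
Qed.

End measurability.

(** * Functions on the circle *)

Section circle_functions.
Variable R : realType.
Local Notation m := (@circle_prob R).
Implicit Types (phi psi : circle R -> R[i]).

Definition cmeasurable phi :=
  measurable_fun setT (fun z => complex.Re (phi z)) /\
  measurable_fun setT (fun z => complex.Im (phi z)).

Definition cintegrable phi :=
  m.-integrable setT (fun z => (complex.Re (phi z))%:E) /\
  m.-integrable setT (fun z => (complex.Im (phi z))%:E).

Definition sqc (a : R[i]) : R := complex.Re a ^+ 2 + complex.Im a ^+ 2.

Lemma cintegralD phi psi : cintegrable phi -> cintegrable psi ->
  cintegral (fun z => phi z + psi z) = cintegral phi + cintegral psi.
Proof.
move=> [p1 p2] [q1 q2]; rewrite /cintegral.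
rewrite (_ : _ +i* _ + _ = (\int[m]_z complex.Re (phi z) +
  \int[m]_z complex.Re (psi z)) +i*
 (\int[m]_z complex.Im (phi z) + \int[m]_z complex.Im (psi z)))//.
rewrite -!RintegralD//; congr (_ +i* _); apply: eq_Rintegral => z _;
  by rewrite ?raddfD.
Qed.

Lemma cintegralZ a phi : cintegrable phi ->
  cintegral (fun z => a * phi z) = a * cintegral phi.
Proof.
move=> [p1 p2]; rewrite /cintegral; case: a => a b.
set u := \int[m]_z complex.Re (phi z).
set v := \int[m]_z complex.Im (phi z).
rewrite (_ : _ * _ = (a * u - b * v) +i* (a * v + b * u))//.
have q1 r : m.-integrable setT (EFin \o (fun z => r * complex.Re (phi z))).
  exact: (integrableZl measurableT r p1).
have q2 r : m.-integrable setT (EFin \o (fun z => r * complex.Im (phi z))).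
  exact: (integrableZl measurableT r p2).
rewrite /u /v -!RintegralZl// -RintegralB// -RintegralD//; congr (_ +i* _);
  by apply: eq_Rintegral => z _; case: (phi z).
Qed.

Lemma cintegral_conj phi : cintegrable phi ->
  cintegral (fun z => Num.conj (phi z)) = Num.conj (cintegral phi).
Proof.
move=> [p1 p2]; rewrite /cintegral /=; congr (_ +i* _).
  by apply: eq_Rintegral => z _; rewrite Re_conj.
rewrite -mulN1r -RintegralZl//; apply: eq_Rintegral => z _.
by rewrite Im_conj mulN1r.
Qed.

Lemma eq_cintegral phi psi : phi =1 psi -> cintegral phi = cintegral psi.
Proof. by move=> /funext ->. Qed.

Lemma open_cRe (a : R) : open [set w : R[i]^o | a < complex.Re w].
Proof.
rewrite openE => x /= ax; apply/nbhs_ballP.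
exists (complex.Re x - a)%:C%C => /=; first by rewrite ltcR subr_gt0.
move=> y; rewrite -ball_normE /ball_ /= normc_def ltcR => xy.
have := le_lt_trans _ xy => /(_ `|complex.Re (x - y)|).
rewrite -sqrtr_sqr ler_wsqrtr ?lerDl ?sqr_ge0// => /(_ isT).
rewrite sqrtr_sqr raddfB/= => /ltr_normlP[]; lra.
Qed.

Lemma open_cIm (a : R) : open [set w : R[i]^o | a < complex.Im w].
Proof.
rewrite openE => x /= ax; apply/nbhs_ballP.
exists (complex.Im x - a)%:C%C => /=; first by rewrite ltcR subr_gt0.
move=> y; rewrite -ball_normE /ball_ /= normc_def ltcR => xy.
have := le_lt_trans _ xy => /(_ `|complex.Im (x - y)|).
rewrite -sqrtr_sqr ler_wsqrtr ?lerDr ?sqr_ge0// => /(_ isT).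
rewrite sqrtr_sqr raddfB/= => /ltr_normlP[]; lra.
Qed.

Lemma cmeasurable_cval : cmeasurable (fun z => cval z).
Proof.
split; apply: measurable_fun_gtP => a; apply: sub_sigma_algebra.
  by exists [set w | a < complex.Re w] => //; exact: open_cRe.
by exists [set w | a < complex.Im w] => //; exact: open_cIm.
Qed.

Lemma Re_mul (a b : R[i]) : complex.Re (a * b) =
  complex.Re a * complex.Re b - complex.Im a * complex.Im b.
Proof. by case: a b => ? ? [? ?]. Qed.

Lemma Im_mul (a b : R[i]) : complex.Im (a * b) =
  complex.Re a * complex.Im b + complex.Im a * complex.Re b.
Proof. by case: a b => ? ? [? ?]. Qed.

Lemma cmeasurableM phi psi : cmeasurable phi -> cmeasurable psi ->
  cmeasurable (fun z => phi z * psi z).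
Proof.
move=> [p1 p2] [q1 q2]; split; under eq_fun do rewrite ?Re_mul ?Im_mul.
  by apply: measurable_funB; apply: measurable_funM.
by apply: measurable_funD; apply: measurable_funM.
Qed.

Lemma cmeasurable_cst a : cmeasurable (fun=> a).
Proof. by split; exact: measurable_cst. Qed.

Lemma cmeasurable_conj phi : cmeasurable phi ->
  cmeasurable (fun z => Num.conj (phi z)).
Proof.
move=> [p1 p2]; split; first by under eq_fun do rewrite Re_conj.
by under eq_fun do rewrite Im_conj; exact: measurable_funN.
Qed.

Lemma sqcM a b : sqc (a * b) = sqc a * sqc b.
Proof. by case: a b => a a' [b b']; rewrite /sqc /=; ring. Qed.

Lemma sqc_conj a : sqc (Num.conj a) = sqc a.
Proof. by rewrite /sqc Re_conj Im_conj sqrrN. Qed.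

Lemma sqc1 : sqc 1 = 1. Proof. by rewrite /sqc /= expr1n expr0n addr0. Qed.

Lemma sqc_ge0 a : 0 <= sqc a. Proof. by rewrite addr_ge0// sqr_ge0. Qed.

Lemma mul_conj a : a * Num.conj a = (sqc a)%:C%C.
Proof.
case: a => a b; rewrite /sqc /=; apply/eqP; rewrite eq_complex/=.
by apply/andP; split; apply/eqP; ring.
Qed.

Lemma sqc_cval (z : circle R) : sqc (cval z) = 1.
Proof.
have /eqP := cvalP z; rewrite normc_def => /complexI h.
have /(congr1 (fun x => x ^+ 2)) := h.
by rewrite sqr_sqrtr ?sqc_ge0// expr1n.
Qed.

Lemma cval_neq0 (z : circle R) : cval z != 0.
Proof.
by apply: contra_eqN (sqc_cval z) => /eqP ->;
  rewrite /sqc /= expr0n addr0 eq_sym oner_eq0.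
Qed.

Lemma cval_conj (z : circle R) : Num.conj (cval z) = (cval z)^-1.
Proof.
apply: (mulfI (cval_neq0 z)); rewrite mulfV ?cval_neq0//.
by rewrite mul_conj sqc_cval.
Qed.

Lemma cval_circle_conj (z : circle R) : cval (circle_conj z) = (cval z)^-1.
Proof. exact: cval_conj. Qed.

(** On the circle the inverse of z is its conjugate, so negative powers are conjugates of positive
    ones. *)
Lemma cval_exp_prop (n : int) :
  cmeasurable (fun z => cval z ^ n) /\ forall z :
    circle R, sqc (cval z ^ n) = 1.
Proof.
have H k : cmeasurable (fun z => cval z ^+ k) /\ forall z :
  circle R, sqc (cval z ^+ k) = 1.
  elim: k => [|k [ihm ihs]].
    split=> [|z]; last by rewrite expr0 sqc1.
    by under eq_fun do rewrite expr0; exact: cmeasurable_cst.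
  split=> [|z]; last by rewrite exprS sqcM sqc_cval ihs mulr1.
  by under eq_fun do rewrite exprS; exact: (cmeasurableM cmeasurable_cval).
case: n => k; first exact: (H k).
have [hm hs] := H k.+1; split=> [|z].
  under eq_fun => z do rewrite NegzE -exprz_inv -cval_conj -exprnP -rmorphXn/=.
  exact: cmeasurable_conj.
by rewrite NegzE -exprz_inv -cval_conj -exprnP -rmorphXn sqc_conj hs.
Qed.

End circle_functions.

(** * The space L2 *)

Section L2_theory.
Variables (R : realType) (E : hilbertType R).
Hypothesis sepE : separable E.
Local Notation m := (@circle_prob R).
Local Notation L2 := (@L2 R E).
Implicit Types f g h : circle R -> E.

Lemma sqnZ (a : R[i]) (x : E) : rdot (a *: x) (a *: x) = sqc a * rdot x x.
Proof.
by rewrite /rdot hdotZl hdotZr mulrA mul_conj Re_mul /= mul0r subr0.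
Qed.

Lemma hdot_circle (z : circle R) (x y : E) :
  hdot (cval z *: x) (cval z *: y) = hdot x y.
Proof.
by rewrite hdotZl hdotZr mulrA cval_conj mulfV ?cval_neq0// mul1r.
Qed.

Lemma L2_meas f : L2 f -> forall e, measurable_fun setT (fun z => rdot (f z) e).
Proof. by move=> [mf _]; exact: measurable_rdot_fun. Qed.

Lemma L2_measr f g : L2 f -> L2 g -> measurable_fun setT (fun z => rdot (f z) (g
  z)).
Proof.
have [d dP] := separable_approx_seq sepE.
by move=> /L2_meas mf /L2_meas mg; exact: (weak_measurable_rdot dP).
Qed.

Lemma L2_intsq f : L2 f -> m.-integrable setT (fun z => (rdot (f z) (f z))%:E).
Proof.
move=> L2f; apply/integrableP; split; first by apply/measurable_EFinP;
  exact: L2_measr.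
apply: le_lt_trans L2f.2; rewrite le_eqVlt; apply/orP; left; apply/eqP.
apply: eq_integral => z _; rewrite -[complex.Re _]/(sqn _) sqnE.
by rewrite gee0_abs// lee_fin rdot_ge0.
Qed.

(** By Pettis, Borel measurability is recovered from scalar functions, so later membership proofs in
    [L2] only deal with real-valued ones. *)
Lemma L2I f : (forall e, measurable_fun setT (fun z => rdot (f z) e)) ->
  m.-integrable setT (fun z => (rdot (f z) (f z))%:E) -> L2 f.
Proof.
have [d dP] := separable_approx_seq sepE.
move=> mf /integrableP[_ fi]; split; first exact: (weak_measurable dP).
apply: le_lt_trans fi; rewrite le_eqVlt; apply/orP; left; apply/eqP.
apply: eq_integral => z _; rewrite -[complex.Re _]/(sqn _) sqnE.
by rewrite gee0_abs// lee_fin rdot_ge0.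
Qed.

Lemma le_Rintegrable (u v : circle R -> R) : measurable_fun setT u ->
  m.-integrable setT (fun z => (v z)%:E) -> (forall z, `|u z| <= v z) ->
  m.-integrable setT (fun z => (u z)%:E).
Proof.
move=> mu iv uv; apply: le_integrable iv => //; first exact/measurable_EFinP.
by move=> z _; rewrite lee_fin (le_trans (uv z))// ler_norm.
Qed.

Lemma RintegrableZ (r : R) (u : circle R -> R) :
  m.-integrable setT (fun z => (u z)%:E) ->
  m.-integrable setT (fun z => (r * u z)%:E).
Proof. by move=> iu; exact: (integrableZl measurableT r iu). Qed.

Lemma RintegrableD (u v : circle R -> R) :
  m.-integrable setT (fun z => (u z)%:E) ->
  m.-integrable setT (fun z => (v z)%:E) ->
  m.-integrable setT (fun z => (u z + v z)%:E).
Proof. by move=> iu iv; exact: (integrableD measurableT iu iv). Qed.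

Lemma L2_intdot f g : L2 f -> L2 g ->
  m.-integrable setT (fun z => (rdot (f z) (g z))%:E).
Proof.
move=> L2f L2g.
apply: (@le_Rintegrable _ (fun z => 2^-1 * (rdot (f z) (f z) +
  rdot (g z) (g z)))).
- exact: L2_measr.
- by apply/RintegrableZ/RintegrableD; exact: L2_intsq.
- by move=> z; rewrite mulrC; exact: rdot_amgm.
Qed.

Lemma L2D f g : L2 f -> L2 g -> L2 (f + g).
Proof.
move=> L2f L2g; have mfg e : measurable_fun setT (fun z => rdot ((f + g) z) e).
  under eq_fun do rewrite rdotDl.
  by apply: measurable_funD; exact: L2_meas.
apply: L2I => //.
apply: (@le_Rintegrable _ (fun z => 2 * rdot (f z) (f z) +
  2 * rdot (g z) (g z))).
- have [d dP] := separable_approx_seq sepE; exact: (weak_measurable_sqn dP).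
- by apply: RintegrableD; apply/RintegrableZ/L2_intsq.
- by move=> z; rewrite ger0_norm ?rdot_ge0// rdotDD_le.
Qed.

Lemma L2M (c : circle R -> R[i]) (M : R) f : cmeasurable c ->
  (forall z, sqc (c z) <= M) -> L2 f -> L2 (fun z => c z *: f z).
Proof.
move=> [c1 c2] cM L2f.
have mcf e : measurable_fun setT (fun z => rdot (c z *: f z) e).
  under eq_fun do rewrite rdotZl Im_hdot.
  apply: measurable_funB; apply: measurable_funM => //; exact: L2_meas.
apply: L2I => //.
apply: (@le_Rintegrable _ (fun z => M * rdot (f z) (f z))).
- have [d dP] := separable_approx_seq sepE; exact: (weak_measurable_sqn dP).
- by apply/RintegrableZ/L2_intsq.
- move=> z; rewrite ger0_norm ?rdot_ge0// sqnZ ler_wpM2r ?rdot_ge0//.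
Qed.

Lemma L2Z (a : R[i]) f : L2 f -> L2 (a *: f).
Proof. by apply: (@L2M (fun=> a) (sqc a)) => //; exact: cmeasurable_cst. Qed.

Lemma L2_cst (e : E) : L2 (fun=> e).
Proof.
apply: L2I => [v|]; first exact: measurable_cst.
by apply: finite_measure_integrable_cst.
Qed.

Lemma L20 : L2 0. Proof. exact: L2_cst. Qed.

Lemma L2B f g : L2 f -> L2 g -> L2 (f - g).
Proof. by move=> L2f L2g; rewrite -scaleN1r; apply: L2D => //; exact: L2Z. Qed.

Lemma L2_zexp (n : int) f : L2 f -> L2 (fun z => cval z ^ n *: f z).
Proof.
have [mz sz] := cval_exp_prop R n.
by apply: (@L2M _ 1) => // z; rewrite sz.
Qed.

Lemma L2_zshift f : L2 f -> L2 (zshift f).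
Proof. by move=> /(L2_zexp 1). Qed.

Lemma L2_cint f g : L2 f -> L2 g -> cintegrable (fun z => hdot (f z) (g z)).
Proof.
move=> L2f L2g; split; first exact: L2_intdot.
under eq_fun do rewrite Im_hdot.
by apply: L2_intdot => //; exact: (@L2Z 'i%C).
Qed.

Lemma L2dotDl f g h : L2 f -> L2 g -> L2 h ->
  L2dot (f + g) h = L2dot f h + L2dot g h.
Proof.
move=> L2f L2g L2h; rewrite /L2dot -cintegralD; try exact: L2_cint.
by apply: eq_cintegral => z; rewrite linearDl.
Qed.

Lemma L2dotZl a f h : L2 f -> L2 h -> L2dot (a *: f) h = a * L2dot f h.
Proof.
move=> L2f L2h; rewrite /L2dot -cintegralZ; try exact: L2_cint.
by apply: eq_cintegral => z; rewrite -hdotZl.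
Qed.

Lemma L2dotC f g : L2 f -> L2 g -> L2dot f g = Num.conj (L2dot g f).
Proof.
move=> L2f L2g; rewrite /L2dot -cintegral_conj; try exact: L2_cint.
by apply: eq_cintegral => z; rewrite -hdotC.
Qed.

Lemma L2dot0l g : L2dot 0 g = 0.
Proof.
rewrite /L2dot /cintegral; under [X in X +i* _]eq_Rintegral do rewrite linear0l.
under [X in _ +i* X]eq_Rintegral do rewrite linear0l.
by rewrite /= Rintegral_cst// mul0r.
Qed.

Lemma L2dot0r g : L2dot g 0 = 0.
Proof.
rewrite /L2dot /cintegral; under [X in X +i* _]eq_Rintegral do rewrite linear0r.
under [X in _ +i* X]eq_Rintegral do rewrite linear0r.
by rewrite /= Rintegral_cst// mul0r.
Qed.

Lemma L2dot_sq f : L2dot f f = (\int[m]_z rdot (f z) (f z))%:C%C.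
Proof.
rewrite /L2dot /cintegral; congr (_ +i* _).
under eq_Rintegral do rewrite ger0_Im//.
by rewrite /= Rintegral_cst// mul0r.
Qed.

Lemma Re_L2dot f g : complex.Re (L2dot f g) = \int[m]_z rdot (f z) (g z).
Proof. by []. Qed.

Lemma L2dot_zshift f g : L2dot (zshift f) (zshift g) = L2dot f g.
Proof. by apply: eq_cintegral => z; rewrite hdot_circle. Qed.

Lemma L2dot_zshift_adj f g :
  L2dot (zshift f) g = L2dot f (fun z => cval z ^ (-1) *: g z).
Proof.
apply: eq_cintegral => z; rewrite -(hdot_circle z (f z)) scalerA.
by rewrite exprN1 mulfV ?cval_neq0// scale1r.
Qed.

End L2_theory.

(** * Completeness of L2 *)

Section hilbert_sequences.
Variables (R : realType) (E : hilbertType R).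
Implicit Types (v : nat -> E) (l x y : E).

Lemma Re_norm_le x (c : R) : 0 <= c -> rdot x x <= c ^+ 2 ->
  complex.Re `|x| <= c.
Proof. by move=> c0; rewrite -Re_norm2 ler_pXn2r ?nnegrE// Re_norm. Qed.

Lemma Re_normD x y : complex.Re `|x + y| <= complex.Re `|x| + complex.Re `|y|.
Proof. by have := ler_normD x y; rewrite lecE => /andP[_]; rewrite raddfD. Qed.

(** The n-th increment has norm at most sqrt(s) / 2^n, so the increments are dominated by a
    geometric series. *)
Lemma fast_cauchy_cvg v (s : R) :
  (forall n, 4 ^+ n * rdot (v n.+1 - v n) (v n.+1 - v n) <= s) ->
  exists l, v n @[n --> \oo] --> l.
Proof.
move=> vs; have s0 : 0 <= s.
  by apply: le_trans (vs 0%N); rewrite expr0 mul1r rdot_ge0.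
pose c := Num.sqrt s; have c0 : 0 <= c by exact: sqrtr_ge0.
have step n : complex.Re `|v n.+1 - v n| <= c * 2^-1 ^+ n.
  apply: Re_norm_le; first by rewrite mulr_ge0// exprn_ge0.
  rewrite exprMn sqr_sqrtr// -exprM mulnC exprM.
  rewrite (_ : 2^-1 ^+ 2 = 4^-1 :> R); last by rewrite exprVn; congr (_^-1);
    ring.
  by rewrite exprVn ler_pdivlMr ?exprn_gt0// mulrC.
(* The exact value of the partial geometric sum, rather than its bound 2c / 2^n, is what makes the
   induction on [k] close. *)
have tail n k : complex.Re `|v (n + k)%N - v n| <= 2 * c * 2^-1 ^+ n * (1 - 2^-1
  ^+ k).
  elim: k => [|k ih].
    by rewrite addn0 subrr normr0 expr0 subrr mulr0.
  rewrite addnS (_ : _ - _ = (v (n + k).+1 - v (n + k)%N) + (v (n +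
    k)%N - v n)); last first.
    by rewrite addrA subrK.
  apply: (le_trans (Re_normD _ _)); apply: (le_trans (lerD (step _) ih)).
  rewrite exprD exprS; set p := _ ^+ n; set q := _ ^+ k; lra.
suff : cvg (v n @[n --> \oo]) by move=> /cvg_ex.
apply: cauchy_cvg; apply: cauchy_exP => -[e e'] /=.
rewrite ltcE /= => /andP[/eqP-> e0].
have : (fun n => 2 * c * 2^-1 ^+ n) @ \oo --> (2 * c * 0 : R).
  by apply: cvgM; [exact: cvg_cst|apply: cvg_expr; rewrite ger0_norm; lra].
rewrite mulr0 => /cvgrPdist_lt /(_ e e0) [n _ /(_ n (leqnn n))] /=.
rewrite sub0r normrN ger0_norm ?mulr_ge0 ?exprn_ge0// => ne.
exists (v n); exists n => // j /= nj.
rewrite -ball_normE /ball_ /= norm_ReE ltcR distrC -(subnKC nj).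
apply: le_lt_trans (tail _ _) _; apply: le_lt_trans ne.
by rewrite ler_piMr ?mulr_ge0 ?exprn_ge0// gerBl exprn_ge0.
Qed.

Lemma cvg_rdotB v l : v n @[n --> \oo] --> l -> forall e : R, 0 < e ->
  \forall n \near \oo, rdot (v n - l) (v n - l) < e.
Proof.
move=> vl e e0; have se : 0 < Num.sqrt e by rewrite sqrtr_gt0.
have se' : (0 : R[i]) < (Num.sqrt e)%:C%C by rewrite ltcR.
have := (cvgrPdist_lt _ _).1 vl _ se'.
move=> [N _ H]; exists N => // n /H /=; rewrite distrC norm_lt// sqr_sqrtr//.
exact: ltW.
Qed.

Lemma cvg_rdotl v l e : v n @[n --> \oo] --> l ->
  rdot (v n) e @[n --> \oo] --> rdot l e.
Proof.
move=> vl; apply/cvgrPdist_lt => eps eps0.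
pose c := rdot e e + 1; have c0 : 0 < c by rewrite ltr_wpDl// rdot_ge0.
have := cvg_rdotB vl (divr_gt0 (exprn_gt0 2 eps0) c0).
move=> [N _ H]; exists N => // n /H /=; rewrite ltr_pdivlMr// => h.
rewrite -rdotBl -sqrtr_sqr -(ger0_norm (ltW eps0)) -(sqrtr_sqr eps).
rewrite ltr_sqrt ?exprn_gt0// (le_lt_trans (rdot_cs _ _))//.
apply: le_lt_trans h; rewrite -opprB rdotNl rdotNr opprK.
by rewrite ler_wpM2l ?rdot_ge0// /c lerDl.
Qed.

Lemma cvg_sqnB v l x : v n @[n --> \oo] --> l ->
  rdot (v n - x) (v n - x) @[n --> \oo] --> rdot (l - x) (l - x).
Proof.
move=> vl.
have h1 : rdot (v n - l) (v n - l) @[n --> \oo] --> (0 : R).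
  apply/cvgrPdist_lt => eps /(cvg_rdotB vl) [N _ H]; exists N => // n /H /=.
  by rewrite sub0r normrN ger0_norm ?rdot_ge0.
have h2 : rdot (v n) (l - x) - rdot l (l - x) @[n --> \oo] --> (0 : R).
  rewrite -(subrr (rdot l (l - x))); apply: cvgB; last exact: cvg_cst.
  exact: cvg_rdotl.
have -> : (fun n => rdot (v n - x) (v n - x)) =
  (fun n => rdot (v n - l) (v n - l) +
    2 * (rdot (v n) (l - x) - rdot l (l - x)) + rdot (l - x) (l - x)).
  apply/funext => n; rewrite -rdotBl.
  rewrite (_ : v n - x = (v n - l) + (l - x)); last by rewrite addrA subrK.
  move: (v n - l) (l - x) => a b.
  by rewrite rdotDl !rdotDr (rdotC b a); ring.
rewrite -[X in _ --> X]add0r -[X in _ --> X + _]addr0 -[X in _ --> _ + X +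
  _](mulr0 2).
by apply: cvgD; [apply: cvgD => //; apply: cvgM => //;
  exact: cvg_cst|exact: cvg_cst].
Qed.

End hilbert_sequences.

Section completeness.
Variables (R : realType) (E : hilbertType R).
Hypothesis sepE : separable E.
Local Notation m := (@circle_prob R).
Local Notation L2 := (@L2 R E).
Implicit Types f g h : circle R -> E.

Definition nsq f : R := \int[m]_z rdot (f z) (f z).

Lemma EFin_nsq f : L2 f -> (nsq f)%:E = (\int[m]_z (rdot (f z) (f z))%:E)%E.
Proof.
move=> L2f; rewrite /nsq /Rintegral fineK//; apply: integrable_fin_num => //.
exact: L2_intsq.
Qed.

Lemma nsq_ge0 f : 0 <= nsq f.
Proof. by apply: Rintegral_ge0 => z _; exact: rdot_ge0. Qed.

(** Fatou's lemma for |v n - g|^2 on [G]. As [f] is a function and not a class, its values off [G]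
    matter: being 0 there, it is the pointwise limit of the [v n] cut off to [G], hence weakly
    measurable. *)
Lemma fatou_L2 (v : nat -> circle R -> E) (G : set (circle R)) f g (e : R) :
  (forall n, L2 (v n)) -> measurable G -> m (~` G) = 0 ->
  (forall z, G z -> v n z @[n --> \oo] --> f z) -> (forall z, ~ G z ->
    f z = 0) ->
  L2 g -> (\forall n \near \oo, nsq (v n - g) <= e) ->
  L2 f /\ nsq (f - g) <= e.
Proof.
move=> L2v mG G0 vf f0 L2g [N _ Ne].
have mf a : measurable_fun setT (fun z => rdot (f z) a).
  apply: (@measurable_fun_cvg _ _ _ _ (fun n z => \1_G z * rdot (v n z) a)).
    move=> n; apply: measurable_funM; last exact: L2_meas.
    exact: measurable_indic.
  move=> z _; have [Gz|nGz] := pselect (G z).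
    under eq_fun do rewrite indicE mem_set// mul1r.
    by apply: cvg_rdotl; exact: vf.
  under eq_fun do rewrite indicE memNset// mul0r.
  by rewrite f0// rdot0l; exact: cvg_cst.
have [d dP] := separable_approx_seq sepE.
have mfg a : measurable_fun setT (fun z => rdot ((f - g) z) a).
  under eq_fun do rewrite rdotBl; apply: measurable_funB => //; exact: L2_meas.
have mfg2 := weak_measurable_sqn dP mfg.
have L2vg n : L2 (v n - g) by exact: L2B.
have key : (\int[m]_z (rdot ((f - g) z) ((f - g) z))%:E <= e%:E)%E.
  rewrite (@ge0_negligible_integral _ _ _ m setT (~` G))//; last 3 first.
  - exact: measurableC.
  - exact/measurable_EFinP.
  - by move=> z _; rewrite lee_fin rdot_ge0.
  rewrite setTD setCK.
  rewrite (@eq_integral _ _ _ m G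
    (fun z => limn_einf (fun n => (rdot ((v n - g) z) ((v n - g) z))%:E)));
      last first.
    move=> z /set_mem Gz; apply/esym; apply: (cvg_limn_einf_sup _).1.
    apply/cvg_EFin; first by near=> n.
    by apply: cvg_sqnB; exact: vf.
  apply: le_trans.
    apply: fatou => // [n|n z _]; last by rewrite lee_fin rdot_ge0.
    by apply: measurable_funTS; apply/measurable_EFinP; exact: L2_measr.
  rewrite limn_einf_lim; apply: lime_le; first exact: is_cvg_einfs.
  exists N => // n /= Nn.
  apply: (@le_trans _ _ (\int[m]_(z in G) (rdot ((v n - g) z) ((v n - g)
    z))%:E)%E).
    by apply: ereal_inf_lbound; exists n => //=.
  apply: (@le_trans _ _ (\int[m]_z (rdot ((v n - g) z) ((v n - g) z))%:E)%E).
    apply: ge0_subset_integral => //; last by move=> z _;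
      rewrite lee_fin rdot_ge0.
    by apply/measurable_EFinP; exact: L2_measr.
  by rewrite -EFin_nsq// lee_fin; exact: Ne.
have L2fg : L2 (f - g).
  apply: L2I => //; apply/integrableP; split; first exact/measurable_EFinP.
  under eq_integral do rewrite gee0_abs ?lee_fin ?rdot_ge0//.
  exact: le_lt_trans key (ltry _).
split; first by rewrite -(subrK g f); exact: L2D.
by rewrite -lee_fin EFin_nsq.
Unshelve. all: by end_near. Qed.

(** The series with terms 4^n |v (n+1) - v n|^2 has integral at most the sum of the 2^-(n+1), so its
    sum [S z] is finite almost everywhere. There [S z] bounds each term, as [fast_cauchy_cvg]
    requires. *)
Lemma fast_cauchy_ae (v : nat -> circle R -> E) : (forall n, L2 (v n)) ->
  (forall n, 4 ^+ n * nsq (v n.+1 - v n) <= (2 ^ n.+1)%:R^-1) ->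
  exists G : set (circle R), [/\ measurable G, m (~` G) = 0 &
    forall z, G z -> exists l : E, v n z @[n --> \oo] --> l].
Proof.
move=> L2v vs.
pose b n z : \bar R := (4 ^+ n * rdot ((v n.+1 - v n) z) ((v n.+1 - v n) z))%:E.
have b0 n z : (0 <= b n z)%E by rewrite lee_fin mulr_ge0 ?exprn_ge0 ?rdot_ge0.
have L2d n : L2 (v n.+1 - v n) by exact: L2B.
have mb n : measurable_fun setT (b n).
  apply: (measurableT_comp (@EFin_measurable _ _)).
  by apply: measurable_funM => //; exact: L2_measr.
pose S z := (\sum_(0 <= n <oo) b n z)%E.
have mS : measurable_fun setT S by apply: ge0_emeasurable_sum => // n z _ _;
  exact: b0.
have S0 z : (0 <= S z)%E by apply: nneseries_ge0 => n _ _; exact: b0.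
have iS : (\int[m]_z S z < +oo)%E.
  rewrite integral_nneseries//.
  apply: (@le_lt_trans _ _ (\sum_(0 <= i <oo) (0 + (1 / (2 ^ i.+1)%:R)%:E))%E).
    apply: lee_nneseries => [n _ _|n _]; first exact: integral_ge0.
    rewrite add0e div1r /b; under eq_integral do rewrite EFinM.
    rewrite ge0_integralZl//; last 2 first.
    - by apply/measurable_EFinP; exact: L2_measr.
    - by move=> z _; rewrite lee_fin rdot_ge0.
    by rewrite -EFin_nsq// -EFinM lee_fin.
  apply: le_lt_trans; first exact: epsilon_trick.
  by rewrite eseries0// add0e ltry.
have : m.-integrable setT S.
  apply/integrableP; split => //.
  by under eq_integral do rewrite gee0_abs//.
move=> /integrable_ae => /(_ measurableT) [N [mN N0 SN]].
exists (~` N); rewrite setCK; split => //; first exact: measurableC.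
move=> z /= Nz.
have Sfin : S z \is a fin_num.
  by apply: contrapT => h; apply: Nz; apply: SN => /= H; apply: h; exact: H.
apply: (@fast_cauchy_cvg _ _ _ (fine (S z))) => n.
rewrite -lee_fin fineK// -[leLHS]/(b n z).
apply: le_trans (nneseries_lim_ge n.+1 _); last by move=> *; exact: b0.
by rewrite big_mkord big_ord_recr/= leeDr// sume_ge0// => i _; exact: b0.
Qed.

Definition L2_cauchy (u : nat -> circle R -> E) := forall e : R, 0 < e ->
  exists N, forall i j, (N <= i)%N -> (N <= j)%N -> nsq (u i - u j) <= e.

Lemma L2_complete (u : nat -> circle R -> E) : (forall n, L2 (u n)) ->
  L2_cauchy u -> exists f, L2 f /\
    forall e : R, 0 < e -> \forall n \near \oo, nsq (u n - f) <= e.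
Proof.
move=> L2u cu.
have eps0 n : (0 : R) < (4 ^+ n * (2 ^ n.+1)%:R)^-1.
  by rewrite invr_gt0 mulr_gt0 ?exprn_gt0// ltr0n expn_gt0.
have [k kP] := choice (fun n => cu _ (eps0 n)).
(* The summand [n] makes the indices tend to infinity, and the sum makes them nondecreasing and at
   least [k n]. *)
pose K n := (n + \sum_(i < n.+1) k i)%N.
have Kk n : (k n <= K n)%N by rewrite /K big_ord_recr/= addnA leq_addl.
have KS n : (K n <= K n.+1)%N by rewrite /K (big_ord_recr n.+1)/= leq_add//
  leq_addr.
have L2v n : L2 (u (K n)) by [].
have [] := @fast_cauchy_ae (fun n => u (K n)) L2v.
  move=> n; have := kP n (K n.+1) (K n) (leq_trans (Kk n) (KS n)) (Kk n).
  by rewrite invfM -ler_pdivlMl ?exprn_gt0// mulrC.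
move=> G [mG G0 cvG].
pose f z := xget 0 [set l | G z /\ u (K n) z @[n --> \oo] --> (l : E)].
have fG z : G z -> u (K n) z @[n --> \oo] --> f z.
  move=> Gz; rewrite /f; case: xgetP => [y _ []//|H].
  by have [l ul] := cvG _ Gz; case: (H l).
have fG0 z : ~ G z -> f z = 0 by move=> nG; rewrite /f;
  case: xgetP => // y _ [].
have Kn n : (n <= K n)%N by rewrite leq_addr.
(* [fatou_L2] along the subsequence with a fixed term [u n] as [g]: the Cauchy bound passes to the
   limit, so the whole sequence converges and not only the subsequence. *)
have near_f (e : R) : 0 < e -> exists N, forall n, (N <= n)%N ->
    L2 f /\ nsq (f - u n) <= e.
  move=> e0; have [N Ne] := cu e e0; exists N => n Nn.
  apply: (fatou_L2 L2v mG G0 fG fG0 (L2u n)).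
  by exists N => // j /= Nj; apply: Ne => //; exact: leq_trans (Kn j).
exists f; split; first by have [N /(_ N (leqnn N))[]] := near_f 1 ltr01.
move=> e /near_f[N Ne]; exists N => // n /= /Ne[_]; congr (_ <= _).
by apply: eq_Rintegral => z _; rewrite -opprB rdotNl rdotNr opprK.
Qed.

End completeness.

(** * The projection theorem *)

Section direct_sum.
Variables (R : realType) (E F : hilbertType R).
Hypotheses (sepE : separable E) (sepF : separable F).
Local Notation m := (@circle_prob R).
Local Notation V := ((circle R -> E) * (circle R -> F))%type.
Local Notation D := (@L2 R E `*` @L2 R F).
Implicit Types (p q r x y : V) (H N M : set V).

Lemma L2pair_D x y : D x -> D y -> D (x + y).
Proof. by move=> [x1 x2] [y1 y2]; split; exact: L2D. Qed.

Lemma L2pair_Z a x : D x -> D (a *: x).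
Proof. by move=> [x1 x2]; split; exact: L2Z. Qed.

Lemma L2pair_B x y : D x -> D y -> D (x - y).
Proof. by move=> [x1 x2] [y1 y2]; split; exact: L2B. Qed.

Lemma sumdotDl x y r : D x -> D y -> D r ->
  sumdot (x + y) r = sumdot x r + sumdot y r.
Proof.
by move=> [? ?] [? ?] [? ?]; rewrite /sumdot !L2dotDl// addrACA.
Qed.

Lemma sumdotZl a x r : D x -> D r -> sumdot (a *: x) r = a * sumdot x r.
Proof. by move=> [? ?] [? ?]; rewrite /sumdot !L2dotZl// mulrDr. Qed.

Lemma sumdotC x y : D x -> D y -> sumdot x y = Num.conj (sumdot y x).
Proof.
by move=> [? ?] [? ?]; rewrite /sumdot rmorphD; congr (_ + _); exact: L2dotC.
Qed.

Lemma sumdotBl x y r : D x -> D y -> D r ->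
  sumdot (x - y) r = sumdot x r - sumdot y r.
Proof.
move=> Dx Dy Dr; rewrite -scaleN1r sumdotDl//; last exact: L2pair_Z.
by rewrite sumdotZl// mulN1r.
Qed.

Lemma sumdotZr a x r : D x -> D r -> sumdot r (a *:
  x) = Num.conj a * sumdot r x.
Proof.
move=> Dx Dr; rewrite sumdotC//; last exact: L2pair_Z.
by rewrite sumdotZl// rmorphM; congr (_ * _); exact/esym/sumdotC.
Qed.

Definition nrm2 x : R := nsq x.1 + nsq x.2.
Definition redot x y : R := complex.Re (sumdot x y).

Lemma sumdot_nrm2 x : sumdot x x = (nrm2 x)%:C%C.
Proof. by rewrite /sumdot !L2dot_sq -rmorphD. Qed.

Lemma redot_nrm2 x : redot x x = nrm2 x.
Proof. by rewrite /redot sumdot_nrm2. Qed.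

Lemma sumnormE x : sumnorm x = Num.sqrt (nrm2 x).
Proof. by rewrite /sumnorm sumdot_nrm2. Qed.

Lemma nrm2_ge0 x : 0 <= nrm2 x.
Proof. by rewrite addr_ge0// nsq_ge0. Qed.

Lemma redotC x y : D x -> D y -> redot x y = redot y x.
Proof. by move=> ? ?; rewrite /redot sumdotC// Re_conj. Qed.

Lemma redotDl x y r : D x -> D y -> D r ->
  redot (x + y) r = redot x r + redot y r.
Proof. by move=> ? ? ?; rewrite /redot sumdotDl// raddfD. Qed.

Lemma redotBl x y r : D x -> D y -> D r ->
  redot (x - y) r = redot x r - redot y r.
Proof. by move=> ? ? ?; rewrite /redot sumdotBl// raddfB. Qed.

Lemma redotZl (t : R) x r : D x -> D r -> redot (t%:C%C *: x) r = t * redot x r.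
Proof. by move=> ? ?; rewrite /redot sumdotZl// Re_mul/= mul0r subr0. Qed.

Lemma sumdotE x y : D x -> D y -> sumdot x y = redot x y +i* redot x ('i%C *:
  y).
Proof.
move=> Dx Dy; rewrite /redot sumdotZr//; case: (sumdot x y) => a b /=.
by congr (_ +i* _); ring.
Qed.

Lemma nrm2_axpy x y (t : R) : D x -> D y ->
  nrm2 (x + t%:C%C *: y) = nrm2 x + 2 * t * redot x y + t ^+ 2 * nrm2 y.
Proof.
move=> Dx Dy; have Dty := L2pair_Z t%:C%C Dy; have Dxy := L2pair_D Dx Dty.
rewrite -!redot_nrm2 redotDl// redotZl// (redotC Dx)// (redotC Dy)//.
by rewrite !redotDl// !redotZl// (redotC Dy Dx); ring.
Qed.

Lemma nrm2N x : D x -> nrm2 (- x) = nrm2 x.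
Proof.
move=> Dx; rewrite /nrm2 /nsq; congr (_ + _); apply: eq_Rintegral => z _;
  by rewrite /= rdotNl rdotNr opprK.
Qed.

Lemma redot_amgm x y (t : R) : D x -> D y ->
  2 * t * redot x y <= nrm2 x + t ^+ 2 * nrm2 y.
Proof.
move=> Dx Dy; have := nrm2_ge0 (x + (- t)%:C%C *: y).
by rewrite nrm2_axpy// sqrrN; lra.
Qed.

Lemma parallelogram x y : D x -> D y ->
  nrm2 (x - y) = 2 * nrm2 x + 2 * nrm2 y - nrm2 (x + y).
Proof.
move=> Dx Dy; have := nrm2_axpy (-1) Dx Dy; have := nrm2_axpy 1 Dx Dy.
rewrite rmorphN rmorph1 scaleN1r scale1r => -> ->; ring.
Qed.

Lemma nrm2Z (t : R) x : D x -> nrm2 (t%:C%C *: x) = t ^+ 2 * nrm2 x.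
Proof.
move=> Dx; rewrite -!redot_nrm2 redotZl//; last exact: L2pair_Z.
by rewrite redotC//; [rewrite redotZl//; ring|exact: L2pair_Z].
Qed.

(** The first-order condition at a minimum. It replaces Cauchy-Schwarz on pairs: orthogonality is
    always derived from a quadratic inequality in [t]. *)
Lemma quadratic_eq0 (b c : R) : 0 <= c ->
  (forall t, 2 * t * b <= t ^+ 2 * c) -> b = 0.
Proof.
(* For [c > 0] the natural choice would be [b / c]; the shift by 1 covers [c = 0] and still leaves
   (c + 2) b^2 <= 0. *)
move=> c0 /(_ (b / (c + 1))) h.
have c1 : 0 < c + 1 by rewrite ltr_wpDl.
have : 2 * b ^+ 2 * (c + 1) <= b ^+ 2 * c.
  have := ler_wpM2r (exprn_ge0 2 (ltW c1)) h.
  rewrite (_ : _ * b * _ = 2 * b ^+ 2 * (c + 1)); last by field; rewrite gt_eqF.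
  by rewrite (_ : _ * c * _ = b ^+ 2 * c)//; field; rewrite gt_eqF.
move=> h2; apply/eqP; rewrite -sqrf_eq0; apply/eqP; nra.
Qed.

Definition tends (u : nat -> V) x :=
  forall e : R, 0 < e -> \forall n \near \oo, nrm2 (u n - x) <= e.

Lemma tendsP (u : nat -> V) x :
  tends u x <-> (fun n => sumnorm (u n - x)) @ \oo --> (0 : R).
Proof.
split=> [h|/cvgrPdist_lt h e e0].
  apply/cvgrPdist_lt => e e0.
  have e2 : 0 < e ^+ 2 / 2 by rewrite divr_gt0// exprn_gt0.
  have [N _ Ne] := h _ e2; exists N => // n /Ne /= ne.
  rewrite sub0r normrN ger0_norm sumnormE ?sqrtr_ge0//.
  rewrite -(ger0_norm (ltW e0)) -sqrtr_sqr ltr_sqrt ?exprn_gt0//; lra.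
have se : 0 < Num.sqrt e by rewrite sqrtr_gt0.
have [N _ Ne] := h _ se; exists N => // n /Ne /=.
rewrite sub0r normrN ger0_norm sumnormE ?sqrtr_ge0//.
by rewrite ltr_sqrt//; exact: ltW.
Qed.

(** Since [redot (u N) y] vanishes, 2t <x, y> = -2t <u N - x, y>, which is at most |u N - x|^2 + t^2
    |y|^2; the first term is arbitrarily small. *)
Lemma tends_redot0 (u : nat -> V) x y : (forall n, D (u n)) -> D x -> D y ->
  tends u x -> (forall n, redot (u n) y = 0) -> redot x y = 0.
Proof.
move=> Du Dx Dy ux uy; apply: (quadratic_eq0 (nrm2_ge0 y)) => t.
apply/ler_addgt0Pr => e /ux [N _ /(_ N (leqnn N)) /= Ne].
have := redot_amgm (- t) (L2pair_B (Du N) Dx) Dy.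
by rewrite redotBl// uy sqrrN; lra.
Qed.

Lemma closed_tends H N (u : nat -> V) x : is_closed_subspace H N ->
  (forall n, N (u n)) -> H x -> tends u x -> N x.
Proof. by move=> [_ _ _ cN] Nu Hx /tendsP; exact: cN. Qed.

Lemma closed_add H N x y : is_closed_subspace H N -> N x -> N y -> N (x + y).
Proof. by move=> [_ _ lN _] Nx Ny; rewrite -(scale1r x); exact: lN. Qed.

Lemma closed_scale H N a x : is_closed_subspace H N -> N x -> N (a *: x).
Proof. by move=> [_ N0 lN _] Nx; rewrite -(addr0 (a *: x)); exact: lN. Qed.

Lemma L2pair_complete (u : nat -> V) : (forall n, D (u n)) ->
  (forall e : R, 0 < e -> exists n0, forall i j, (n0 <= i)%N -> (n0 <= j)%N ->
     nrm2 (u i - u j) <= e) ->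
  exists2 x, D x & tends u x.
Proof.
move=> Du cu.
have c1 : L2_cauchy (fun n => (u n).1).
  move=> e /cu[N Ne]; exists N => i j Ni Nj; apply: le_trans (Ne i j Ni Nj).
  by rewrite lerDl nsq_ge0.
have c2 : L2_cauchy (fun n => (u n).2).
  move=> e /cu[N Ne]; exists N => i j Ni Nj; apply: le_trans (Ne i j Ni Nj).
  by rewrite lerDr nsq_ge0.
have [f [L2f uf]] := L2_complete sepE (fun n => (Du n).1) c1.
have [g [L2g ug]] := L2_complete sepF (fun n => (Du n).2) c2.
exists (f, g) => // e e0; have e2 : 0 < e / 2 by rewrite divr_gt0.
have [N1 _ h1] := uf _ e2; have [N2 _ h2] := ug _ e2.
exists (maxn N1 N2) => // n /=; rewrite geq_max => /andP[n1 n2].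
by rewrite [leRHS](splitr e); apply: lerD; [exact: h1|exact: h2].
Qed.

Lemma projection N x : is_closed_subspace D N -> D x ->
  exists2 y, N y & forall z, N z -> sumdot (x - y) z = 0.
Proof.
move=> cN Dx; have [ND N0 lN _] := cN.
pose S := [set nrm2 (x - y) | y in N]; pose d := inf S.
have hS : has_inf S.
  split; first by exists (nrm2 (x - 0)), 0.
  by exists 0 => _ [y _ <-]; exact: nrm2_ge0.
have dS y : N y -> d <= nrm2 (x - y) by move=> Ny; apply: ge_inf => //;
  [exact: hS.2|exists y].
have /choice[u uP] n : exists y, N y /\ nrm2 (x - y) < d + n.+1%:R^-1.
  have n0 : (0 : R) < n.+1%:R^-1 by rewrite invr_gt0.
  have [_ [y Ny <-] yd] := inf_adherent n0 hS.
  by exists y.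
have Nu n : N (u n) by have [] := uP n.
have Du n : D (u n) by exact: ND.
have Dxu n : D (x - u n) by exact: L2pair_B.
have small (e : R) : 0 < e -> exists n0, forall n, (n0 <= n)%N ->
  n.+1%:R^-1 <= e.
  move=> e0; have [n0] := ltr_add_invr e0; rewrite add0r => he.
  exists n0 => n nn0; apply: le_trans (ltW he).
  by rewrite lef_pV2 ?posrE// ler_nat ltnS.
have [|q Dq uq] := L2pair_complete Du.
  move=> e e0; have e4 : 0 < e / 4 by rewrite divr_gt0.
  have [n0 hn0] := small _ e4; exists n0 => i j ni nj.
  (* The midpoint of [u i] and [u j] lies in [N], so the sum of the two differences has square norm
     at least 4d. The parallelogram law leaves 4 (d + e / 4) - 4 d = e. *)
  have -> : u i - u j = (x - u j) - (x - u i).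
    by rewrite opprB [RHS]addrC addrA subrK.
  rewrite parallelogram//.
  have -> : x - u j + (x - u i) = (2 : R)%:C%C *: (x - (2^-1 : R)%:C%C *:
    (u i + u j)).
    rewrite scalerBr scalerA -rmorphM mulfV// scale1r.
    rewrite (_ : (2 : R)%:C%C = 1 + 1); last by rewrite rmorph_nat mulr2n.
    by rewrite scalerDl !scale1r opprD addrACA (addrC (- u j)).
  have Nm : N ((2^-1 : R)%:C%C *: (u i + u j)).
    by apply: (closed_scale _ cN); exact: (closed_add cN).
  rewrite nrm2Z; last by apply: L2pair_B => //; exact: ND.
  have near_d k : (n0 <= k)%N -> nrm2 (x - u k) <= d + e / 4.
    by move=> /hn0 nk; rewrite (le_trans (ltW (uP k).2))// lerD2l.
  by have := dS _ Nm; have := near_d _ ni; have := near_d _ nj; lra.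
have Nq : N q by exact: (closed_tends cN Nu Dq uq).
have key z : N z -> redot (x - q) z = 0.
  move=> Nz; have Dz := ND _ Nz.
  (* The variation is made at [u n], so the distance from [x] to [q] is never computed. The factor 2
     arises because <x - u n, z> and <u n - q, z> each cost t^2 |z|^2 and e / 2. *)
  apply: (@quadratic_eq0 _ (2 * nrm2 z)); first by rewrite mulr_ge0// nrm2_ge0.
  move=> t; apply/ler_addgt0Pr => e e0.
  have e2 : 0 < e / 2 by rewrite divr_gt0.
  have [n1 h1] := small _ e2; have [n2 _ h2] := uq _ e2.
  pose n := maxn n1 n2.
  have h3 : nrm2 (x - u n) <= d + e / 2.
    by rewrite (le_trans (ltW (uP n).2))// lerD2l h1// leq_maxl.
  have := h2 n (leq_maxr _ _) => /=.
  have -> : x - q = (x - u n) + (u n - q) by rewrite addrA subrK.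
  have Dunq : D (u n - q) by exact: L2pair_B.
  rewrite redotDl//.
  have := redot_amgm t Dunq Dz.
  have := dS _ (closed_add cN (Nu n) (closed_scale t%:C%C cN Nz)).
  have -> : x - (u n + t%:C%C *: z) = (x - u n) + (- t)%:C%C *: z.
    by rewrite rmorphN scaleNr opprD addrA.
  by rewrite nrm2_axpy// sqrrN; lra.
exists q => // z Nz; rewrite sumdotE ?key//; try exact: L2pair_B; try exact: ND.
exact: (closed_scale _ cN).
Qed.

End direct_sum.

(** * The Hardy space and the backward shift *)

Section hardy_space.
Variables (R : realType) (E : hilbertType R).
Hypothesis sepE : separable E.
Local Notation L2 := (@L2 R E).
Local Notation H2 := (@hardy R E).
Implicit Types f g h : circle R -> E.

Definition zmono (n : int) (e : E) : circle R -> E := fun z => cval z ^ n *: e.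

Lemma L2_zmono n e : L2 (zmono n e).
Proof. by apply: (L2_zexp sepE n (L2_cst sepE e)). Qed.

Lemma zshift_zmono n e : zshift (zmono n e) = zmono (1 + n) e.
Proof.
apply/funext => z; rewrite /zshift /zmono scalerA.
by rewrite expfzDr ?cval_neq0// expr1z.
Qed.

Lemma conj_cval_expz (z : circle R) n : Num.conj (cval z ^ n) = cval z ^ (- n).
Proof.
rewrite -invr_expz; apply: (mulfI (expfz_neq0 n (cval_neq0 z))).
rewrite mulfV ?expfz_neq0 ?cval_neq0// mul_conj.
by have [_ ->] := cval_exp_prop R n.
Qed.

Lemma L2dot_zmono f n e :
  L2dot f (zmono n e) = cintegral (fun z => cval z ^ (- n) * hdot (f z) e).
Proof. by apply: eq_cintegral => z; rewrite hdotZr conj_cval_expz. Qed.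

(** Vanishing Fourier coefficients become orthogonality to monomials, the form to which
    [ominus_closed] applies. *)
Lemma hardyP f :
  H2 f <-> L2 f /\ forall n : int, n < 0 -> forall e, L2dot f (zmono n e) = 0.
Proof.
split=> -[L2f fn]; split => // n n0 e; have := fn n n0 e;
  by rewrite L2dot_zmono linear0l.
Qed.

Lemma hardy_L2 f : H2 f -> L2 f.
Proof. by case. Qed.

Lemma hardy0 : H2 0.
Proof. by apply/hardyP; split=> [|n n0 e]; [exact: L20|rewrite L2dot0l]. Qed.

Lemma hardy_zshift f : H2 f -> H2 (zshift f).
Proof.
move=> /hardyP[L2f fn]; apply/hardyP; split => [|n n0 e];
  first exact: L2_zshift.
rewrite (_ : zmono n e = zshift (zmono (n - 1) e)); last first.
  by rewrite zshift_zmono addrC subrK.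
rewrite L2dot_zshift fn//; lia.
Qed.

Lemma L2dotBl f g h : L2 f -> L2 g -> L2 h ->
  L2dot (f - g) h = L2dot f h - L2dot g h.
Proof.
move=> L2f L2g L2h; rewrite -scaleN1r L2dotDl//; last exact: L2Z.
by rewrite L2dotZl// mulN1r.
Qed.

End hardy_space.

(** * Closed subspaces obtained as orthogonal complements *)

Section closed_subspaces.
Variables (R : realType) (E F : hilbertType R).
Hypotheses (sepE : separable E) (sepF : separable F).
Local Notation V := ((circle R -> E) * (circle R -> F))%type.
Local Notation D := (@L2 R E `*` @L2 R F).
Implicit Types (p q x y : V) (H N M : set V).

Lemma L2pair_closed : is_closed_subspace D D.
Proof.
split => //; first by split; exact: L20.
by move=> a p q Dp Dq; apply: L2pair_D => //; exact: L2pair_Z.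
Qed.

Lemma closed_trans H N : is_closed_subspace D H -> is_closed_subspace H N ->
  is_closed_subspace D N.
Proof.
move=> [HD H0 lH cH] [NH N0 lN cN]; split => //.
  by move=> x /NH /HD.
move=> u p Nu Dp up; apply: (cN u) => //; apply: (cH u) => // n.
exact: NH.
Qed.

Lemma ominus_closed H M : is_closed_subspace D H -> M `<=` D ->
  is_closed_subspace H (ominus H M).
Proof.
move=> [HD H0 lH cH] MD; split.
- by move=> x [].
- by split => // q _; rewrite /sumdot !L2dot0l addr0.
- move=> a p q [Hp Mp] [Hq Mq]; split; first exact: lH.
  move=> r Mr; rewrite (sumdotDl sepE sepF); last 3 first.
  + by apply: L2pair_Z => //; exact: HD.
  + exact: HD.
  + exact: MD.
  rewrite (sumdotZl sepE sepF) ?Mp ?Mq ?mulr0 ?addr0//; [exact: HD|exact: MD].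
- move=> u p uH Hp /tendsP up; split => // q Mq.
  have Dq := MD _ Mq; have Dp := HD _ Hp.
  have Du n : D (u n) by apply: HD; have [] := uH n.
  (* Only real orthogonality is known to pass to limits; testing against iq recovers the imaginary
     part. *)
  have Diq := L2pair_Z sepE sepF 'i%C Dq.
  have uq n : sumdot (u n) q = 0 by have [_] := uH n; exact.
  rewrite (sumdotE sepE sepF)//; congr (_ +i* _).
    by apply: (tends_redot0 sepE sepF Du) up _ => // n; rewrite /redot uq.
  apply: (tends_redot0 sepE sepF Du) up _ => // n.
  by rewrite /redot sumdotZr// uq mulr0.
Qed.

Lemma L2_hardy_closed : is_closed_subspace D (@L2 R E `*` @hardy R F).
Proof.
pose M : set V := [set q | exists (n : int) e, n < 0 /\ q = (0, zmono n e)].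
rewrite (_ : @L2 R E `*` @hardy R F = ominus D M).
  apply: ominus_closed => [|_ [n [e [_ ->]]]]; first exact: L2pair_closed.
  by split; [exact: L20|exact: L2_zmono].
apply/seteqP; split=> [x [x1 /hardyP[]// x2 xn]|x [[x1 x2] xM]].
  by split => // _ [n [e [n0 ->]]]; rewrite /sumdot /= L2dot0r add0r xn.
split => //; apply/hardyP; split => // n n0 e.
have := xM (0, zmono n e); rewrite /sumdot /= L2dot0r add0r; apply.
by exists n, e.
Qed.

Lemma hardy_hardy_closed : is_closed_subspace D (@hardy R E `*` @hardy R F).
Proof.
pose M : set V := [set q | exists (n : int) e, n < 0 /\ q = (zmono n e, 0)].
apply: (closed_trans L2_hardy_closed).
rewrite (_ : @hardy R E `*` @hardy R F = ominus (@L2 R E `*` @hardy R F) M).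
  apply: ominus_closed => [|_ [n [e [_ ->]]]]; first exact: L2_hardy_closed.
  by split; [exact: L2_zmono|exact: L20].
apply/seteqP; split=> [x [/hardyP[]// x1 xn x2]|x [[x1 x2] xM]].
  by split => // _ [n [e [n0 ->]]]; rewrite /sumdot /= L2dot0r addr0 xn.
split => //; apply/hardyP; split => // n n0 e.
have := xM (zmono n e, 0); rewrite /sumdot /= L2dot0r addr0; apply.
by exists n, e.
Qed.

End closed_subspaces.

Section backward_shift.
Variables (R : realType) (E : hilbertType R).
Hypothesis sepE : separable E.
Local Notation H2 := (@hardy R E).

(* The adjoint of the shift on [H2] sends [g] to the projection onto [H2] of
   [z^-1 g]. *)
Lemma adjoint_zshift g : H2 g ->
  H2 (adjoint_on H2 (@zshift R E) g) /\
  forall f, H2 f -> L2dot (zshift f) g =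
    L2dot f (adjoint_on H2 (@zshift R E) g).
Proof.
move=> H2g; have L2g := hardy_L2 H2g.
pose g' := fun z => cval z ^ (-1) *: g z.
have L2g' : L2 g' by exact: L2_zexp.
rewrite /adjoint_on.
set S := [set h | _]; suff : exists h, S h by move=> /(xgetPex 0).
(* The pair projection theorem is used with [E] twice and first component 0, so that only [y2]
   carries information. *)
have [||[y1 y2] [L2y1 H2y2] yP] := @projection _ E E sepE sepE
  (@L2 R E `*` H2) (0, g').
- exact: L2_hardy_closed.
- by split => //; exact: L20.
exists y2; split => // f H2f; have L2f := hardy_L2 H2f;
  have L2y2 := hardy_L2 H2y2.
rewrite L2dot_zshift_adj -/g' L2dotC// [RHS]L2dotC//; congr (Num.conj _).
have := yP (0, f); rewrite /sumdot /= L2dot0r add0r (L2dotBl sepE)//.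
by move=> /(_ _)/subr0_eq; apply; split => //; exact: L20.
Qed.

End backward_shift.

(** * Symmetry of the circle measure and integrals of powers *)

Section circle_measure.
Variable R : realType.
Local Notation m := (@circle_prob R).
Local Notation mu := (@lebesgue_measure R).

Lemma cval_expi_exp (t : R) n :
  cval (expi t) ^+ n = cos (n%:R * t) +i* sin (n%:R * t).
Proof.
elim: n => [|n ih]; first by rewrite mul0r cos0 sin0 expr0.
rewrite exprS ih -natr1 mulrDl mul1r cosD sinD /=; apply/eqP.
by rewrite eq_complex /=; apply/andP; split; apply/eqP; ring.
Qed.

(** By uniqueness of Lebesgue measure it suffices to treat half-open intervals; reflection moves the
    closed end to the other side but keeps the length. *)
Lemma lebesgue_measure_reflect (c : R) (A : set R) : measurable A ->
  pushforward mu ((fun t => c - t) : measurableTypeR R ->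
    measurableTypeR R) A = mu A.
Proof.
have mr : measurable_fun setT (fun t : R => c - t).
  by apply: measurable_funB.
move=> mA; apply/esym/lebesgue_measure_unique => //= _ [[a b]] _ <-.
rewrite /pushforward.
rewrite (_ : _ @^-1` _ = [set` `[c - b, c - a[]); last first.
  by apply/seteqP; split => t /=; rewrite !in_itv /= => /andP[? ?]; apply/andP;
    split; lra.
rewrite !lebesgue_measure_itv/= !lte_fin.
rewrite ltrD2l ltrN2; case: ifP => // _; rewrite -!EFinD; congr (_%:E); ring.
Qed.

Lemma uniform_probE (A : set R) : measurable A ->
  uniform_prob (@twopi_gt0 R) A = ((2 * pi)^-1%:E * mu (A `&` `[0%R, (2 *
    pi)%R]%classic))%E.
Proof.
move=> mA; rewrite /uniform_prob integral_uniform_pdf.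
rewrite (@eq_integral _ _ _ _ _ (fun=> ((2 * pi)^-1)%:E)); last first.
  move=> t; rewrite inE => -[_]; rewrite /= in_itv /= => h.
  by rewrite /uniform_pdf h subr0.
by rewrite integral_cst//; apply: measurableI.
Qed.

Lemma expi_reflect (t : R) : expi (2 * pi - t) = circle_conj (expi t).
Proof.
apply: val_inj => /=; rewrite mulr_natl addrC; congr (_ +i* _).
  by rewrite cosD2pi cosN.
by rewrite sinD2pi sinN.
Qed.

Lemma measurable_circle_conj : measurable_fun setT (@circle_conj R).
Proof.
apply: (@measurability _ _ _ _ _ _ (@circle_open R)) => //.
move=> _ [_ [U oU <-] <-]; rewrite setTI; apply: sub_sigma_algebra.
exists [set w : R[i]^o | U (Num.conj w)]; last by [].
rewrite openE => x /= Ux; apply/nbhs_ballP.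
have /nbhs_ballP[e e0 eU] : nbhs (Num.conj x : R[i]^o) U by exact:
  open_nbhs_nbhs.
exists e => // y; rewrite -ball_normE /ball_ /= => xy; apply: eU.
by rewrite -ball_normE /ball_ /= -rmorphB norm_conjC.
Qed.

(** In the angle, conjugation is t -> 2 pi - t, which, unlike t -> -t, maps [0, 2 pi] to itself and
    preserves Lebesgue measure. *)
Lemma circle_prob_conj (A : set (circle R)) : measurable A ->
  m (@circle_conj R @^-1` A) = m A.
Proof.
move=> mA.
have mB : measurable (@expi R @^-1` A).
  by have := @measurable_expi R measurableT _ mA; rewrite setTI.
have mcA : measurable (@circle_conj R @^-1` A).
  by have := @measurable_circle_conj measurableT _ mA; rewrite setTI.
have mcB : measurable (@expi R @^-1` (@circle_conj R @^-1` A)).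
  by have := @measurable_expi R measurableT _ mcA; rewrite setTI.
rewrite -[LHS]/(uniform_prob (@twopi_gt0 R) (@expi R @^-1` (@circle_conj R @^-1`
  A))).
rewrite -[RHS]/(uniform_prob (@twopi_gt0 R) (@expi R @^-1` A)).
rewrite !uniform_probE//; congr (_ * _)%E.
rewrite -[RHS](lebesgue_measure_reflect (2 * pi)); last exact: measurableI.
rewrite /pushforward; congr (mu _); apply/seteqP; split => t /=.
  move=> [At]; rewrite !in_itv /= expi_reflect => h; split => //.
  by case/andP: h => ? ?; apply/andP; split; lra.
move=> [At]; rewrite !in_itv /= -expi_reflect => h; split => //.
by case/andP: h => ? ?; apply/andP; split; lra.
Qed.

HB.instance Definition _ :=
  isMeasurableFun.Build _ _ _ _ (@circle_conj R) measurable_circle_conj.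

Lemma integral_circle_conjE (f : circle R -> \bar R) :
  (\int[pushforward m (@circle_conj R)]_z f z = \int[m]_z f z)%E.
Proof. by apply: eq_measure_integral => A mA _; exact: circle_prob_conj. Qed.

Lemma ge0_integral_circle_conj (f : circle R -> \bar R) :
  measurable_fun setT f -> (forall z, 0 <= f z)%E ->
  (\int[m]_z f (circle_conj z) = \int[m]_z f z)%E.
Proof.
move=> mf f0; rewrite -[RHS]integral_circle_conjE (ge0_integral_pushforward
  measurable_circle_conj)//.
Qed.

Lemma Rintegrable_circle_conj (u : circle R -> R) :
  m.-integrable setT (fun z => (u z)%:E) ->
  m.-integrable setT (fun z => (u (circle_conj z))%:E).
Proof.
move=> iu; have /measurable_EFinP mu' := measurable_int _ iu.
have muc := measurableT_comp mu' measurable_circle_conj.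
apply/integrableP; split; first exact/measurable_EFinP.
have /integrableP[_] := iu; rewrite -ge0_integral_circle_conj//.
by apply: (measurableT_comp (@abse_measurable _ _));
  exact: (measurable_int m iu).
Qed.

Lemma Rintegral_circle_conj (u : circle R -> R) :
  m.-integrable setT (fun z => (u z)%:E) ->
  \int[m]_z u (circle_conj z) = \int[m]_z u z.
Proof.
move=> iu; congr (fine _); rewrite -[RHS]integral_circle_conjE.
rewrite (integral_pushforward measurable_circle_conj)//=;
  first exact: (measurable_int m iu).
exact: Rintegrable_circle_conj.
Qed.

Lemma cintegral_circle_conj (phi : circle R -> R[i]) : cintegrable phi ->
  cintegral (fun z => phi (circle_conj z)) = cintegral phi.
Proof.
move=> [p1 p2]; rewrite /cintegral; congr (_ +i* _).
  exact: (@Rintegral_circle_conj (fun z => complex.Re (phi z))).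
exact: (@Rintegral_circle_conj (fun z => complex.Im (phi z))).
Qed.

Lemma integral_circle_prob (f : circle R -> \bar R) :
  measurable_fun setT f -> (forall z, 0 <= f z)%E ->
  (\int[m]_z f z = (2 * pi)^-1%:E *
     \int[mu]_(t in `[0%R, (2 * pi)%R]) f (expi t))%E.
Proof.
move=> mf f0; rewrite ge0_integral_distribution// integral_uniform/= ?subr0//.
exact: measurableT_comp.
Qed.

Lemma cintegrable_zexp (n : nat) : cintegrable (fun z :
  circle R => cval z ^+ n).
Proof.
have [[m1 m2] b] := cval_exp_prop R (Posz n).
have i1 : m.-integrable setT (EFin \o (fun=> 1 : R)).
  exact: finite_measure_integrable_cst.
split; [apply: (le_Rintegrable m1 i1)|apply: (le_Rintegrable m2 i1)] => z;
  have := b z; rewrite /sqc ler_norml.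
- by have := sqr_ge0 (complex.Im (cval z ^ n)) => ? ?; apply/andP; split; nra.
- by have := sqr_ge0 (complex.Re (cval z ^ n)) => ? ?; apply/andP; split; nra.
Qed.

(** The change of variables to the angle is stated for nonnegative functions, so 1 is added to the
    real part. The resulting 1 + cos(nt) has primitive [F], which grows by exactly 2 pi over
    [0, 2 pi]. *)
Lemma Re_int_cval_exp n : (0 < n)%N -> \int[m]_z complex.Re (cval z ^+ n) = 0.
Proof.
move=> n0.
pose u z := complex.Re (cval z ^+ n) : R.
have [iu _] := cintegrable_zexp n.
have /measurable_EFinP mu' := measurable_int m iu.
have u1 z : `|u z| <= 1.
  have [_ bu] := cval_exp_prop R (Posz n).
  have := bu z; rewrite /sqc -/(u z) => bz; rewrite ler_norml.
  have : 0 <= complex.Im (cval z ^ n) ^+ 2 by exact: sqr_ge0.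
  by move=> ?; apply/andP; split; nra.
suff : (\int[m]_z (1 + u z)%:E = 1)%E.
  move=> h1; have : \int[m]_z (1 + u z) = 1 by rewrite /Rintegral h1.
  rewrite RintegralD//; last exact: finite_measure_integrable_cst.
  rewrite Rintegral_cst// (_ : fine _ = 1) ?mulr1; last first.
    by rewrite -[RHS]/(fine 1%:E); congr fine; exact: probability_setT.
  by move=> h; apply: (addrI 1); rewrite addr0.
have u0 z : 0 <= 1 + u z by have := u1 z; rewrite ler_norml => /andP[]; lra.
have mu1 : measurable_fun setT (fun z => (1 + u z)%:E).
  by apply/measurable_EFinP; exact: measurable_funD.
rewrite integral_circle_prob//.
pose F (t : R) := t + n%:R^-1 * sin (n%:R * t).
have n1 : n%:R != 0 :> R by rewrite pnatr_eq0 -lt0n.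
have dF (t : R) : is_derive t 1 F (1 + cos (n%:R * t)).
  have d1 : is_derive t 1 (fun s : R => n%:R * s) n%:R.
    by apply: is_derive_eq; rewrite scaler1.
  have d2 : is_derive t 1 (sin \o (fun s :
    R => n%:R * s)) (cos (n%:R * t) * n%:R).
    exact: is_derive1_comp.
  have := is_deriveD (is_derive_id t (1 : R)) (is_deriveZ n%:R^-1 d2).
  by rewrite mulrC [_ *: _]mulrA mulVf// mul1r.
have cF : continuous F.
  move=> t; apply: differentiable_continuous; apply/derivable1_diffP.
  by have [] := dF t.
rewrite (@continuous_FTC2 _ _ F); first last.
- by move=> t _; rewrite derive1E; have [_ ->] := dF t;
  rewrite /u cval_expi_exp.
- split; first by move=> t _; have [] := dF t.
  + by apply: cvg_at_right_filter; exact: cF.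
  + by apply: cvg_at_left_filter; exact: cF.
- rewrite (_ : (fun t => 1 + u (expi t)) = (fun t => 1 + cos (n%:R * t)));
  last first.
    by apply/funext => t; rewrite /u cval_expi_exp.
  apply: continuous_subspaceT => t; apply: cvgD; first exact: cvg_cst.
  apply: (@continuous_comp _ _ _ (fun s : R => n%:R * s) cos).
    exact: mulrl_continuous.
  exact: continuous_cos.
- exact: twopi_gt0.
have s0 : sin (n%:R * (2 * pi)) = 0 :> R.
  have e1 : cval (expi (2 * pi)) = 1 :> R[i].
    transitivity ((cos (2 * pi) : R) +i* sin (2 * pi)); first by [].
    by rewrite (_ : 2 * pi = pi *+ 2) ?mulr_natl// cos2pi sin2pi.
  have := cval_expi_exp (2 * pi) n.
  by rewrite e1 expr1n => /(congr1 (@complex.Im R)) /= <-.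
rewrite /F s0 !mulr0 sin0 !mulr0 !addr0 sube0 -EFinM mulVf//.
by rewrite gt_eqF// twopi_gt0.
Qed.

Lemma cintegral_zexp (n : nat) : (0 < n)%N ->
  cintegral (fun z : circle R => cval z ^+ n) = 0.
Proof.
move=> n0; rewrite /cintegral Re_int_cval_exp//; congr (_ +i* _).
(* Conjugation preserves the measure and changes the sign of Im z^n. *)
set I := Rintegral _ _ _; suff : I = - I by move=> ?; lra.
have [_ ii] := cintegrable_zexp n.
rewrite /I -[LHS](@Rintegral_circle_conj (fun z => complex.Im (cval z ^+ n)))//.
rewrite -mulN1r -RintegralZl//; apply: eq_Rintegral => z _.
rewrite [cval (circle_conj z)]/= -rmorphXn mulN1r; exact: Im_conj.
Qed.

End circle_measure.

(** * Totality of the functions z^n e *)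

Section sign_iteration.
Variable R : realType.

(* A polynomial iteration converging to the sign function on [-1, 1]; it puts
   the indicator of {a > 0} among the multipliers as soon as a is one. *)
Definition sgstep (v : R) := (3 * v - v ^+ 3) / 2.

Lemma iter_sgstepN n v : iter n sgstep (- v) = - iter n sgstep v.
Proof.
elim: n => //= n ->; rewrite /sgstep; lra.
Qed.

(** 1 and -1 are fixed points of [sgstep] with zero derivative: 1 - sgstep w = (1 - w)^2 (2 + w) /
    2, and symmetrically at -1. *)
Lemma iter_sgstep_itv n v : -1 <= v <= 1 -> -1 <= iter n sgstep v <= 1.
Proof.
move=> v1; elim: n => //= n; set w := iter n _ _ => /andP[w1 w2].
rewrite /sgstep; apply/andP; split.
  have : 0 <= (w + 1) ^+ 2 * (2 - w) by rewrite mulr_ge0 ?sqr_ge0//; lra.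
  rewrite (_ : _ * _ = 2 + 3 * w - w ^+ 3); [lra|ring].
have : 0 <= (1 - w) ^+ 2 * (2 + w) by rewrite mulr_ge0 ?sqr_ge0//; lra.
rewrite (_ : _ * _ = 2 - 3 * w + w ^+ 3); [lra|ring].
Qed.

(** Each step adds w (1 - w^2) / 2 >= 0, so the iterates increase to a fixed point in [v, 1]. The
    fixed points are 0, 1 and -1, and v > 0 leaves only 1. *)
Lemma iter_sgstep_pos v : 0 < v <= 1 -> iter n sgstep v @[n --> \oo] --> (1 :
  R).
Proof.
move=> /andP[v0 v1].
have v11 : -1 <= v <= 1 by apply/andP; split; lra.
have itv n : iter n sgstep v <= 1 by have /andP[] := iter_sgstep_itv n v11.
have pos n : v <= iter n sgstep v.
  elim: n => //= n; set w := iter n _ _ => vw; rewrite /sgstep.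
  have w1 := itv n; rewrite -/w in w1.
  have : 0 <= w * (1 - w ^+ 2) by rewrite mulr_ge0//; nra.
  rewrite (_ : _ * _ = w - w ^+ 3); [lra|ring].
have nd : nondecreasing_seq (fun n => iter n sgstep v).
  apply/nondecreasing_seqP => n /=; have w1 := itv n; have w0 := pos n.
  set w := iter n _ _ in w0 w1 *; rewrite /sgstep.
  have : 0 <= w * (1 - w ^+ 2) by rewrite mulr_ge0//; nra.
  rewrite (_ : _ * _ = w - w ^+ 3); [lra|ring].
have cv : cvgn (fun n => iter n sgstep v).
  by apply: nondecreasing_is_cvgn => //; exists 1 => _ [n _ <-].
pose l := limn (fun n => iter n sgstep v).
have l1 : l <= 1 by apply: limr_le => //; exact: nearW.
have l0 : v <= l by apply: limr_ge => //; exact: nearW.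
have cl : iter n sgstep v @[n --> \oo] --> l by [].
have cs : iter n.+1 sgstep v @[n --> \oo] --> sgstep l.
  rewrite /sgstep; apply: cvgM; last exact: cvg_cst.
  apply: cvgB; first by apply: cvgM; [exact: cvg_cst|].
  exact: (continuous_cvg _ (@exprn_continuous R 3 l) cl).
have cl' : iter n.+1 sgstep v @[n --> \oo] --> l by have := cl;
  rewrite -cvg_shiftS.
have E : sgstep l = l by exact: (cvg_unique _ cs cl').
suff <- : l = 1 by [].
have : l * (1 - l) * (1 + l) = 0 by move: E; rewrite /sgstep; nra.
move=> /eqP; rewrite !mulf_eq0 => /orP[/orP[]|] /eqP ?; lra.
Qed.

Lemma iter_sgstep_cvg v : -1 <= v <= 1 ->
  iter n sgstep v @[n --> \oo] --> Num.sg v.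
Proof.
move=> /andP[v1 v2]; case: (sgrP v) => [->|v0|v0].
- rewrite (_ : (fun n => _) = (fun=> 0)); first exact: cvg_cst.
  apply/funext => n; elim: n => //= n ->; rewrite /sgstep; lra.
- by apply: iter_sgstep_pos; rewrite v0.
- rewrite (_ : (fun n => _) = (fun n => - iter n sgstep (- v))).
    by apply: cvgN; apply: iter_sgstep_pos; apply/andP; split; lra.
  by apply/funext => n; rewrite iter_sgstepN opprK.
Qed.

End sign_iteration.

(** * Bounded multipliers of the annihilator of the monomials *)

Section totality.
Variables (R : realType) (E : hilbertType R).
Hypothesis sepE : separable E.
Local Notation m := (@circle_prob R).
Local Notation L2 := (@L2 R E).
Implicit Types (f g h : circle R -> E) (a b : circle R -> R).

(** Real parts suffice because [e] may be replaced by ie; limit arguments then involve real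
    integrals only. *)
Definition annihilated h := L2 h /\
  forall n e, \int[m]_z rdot (h z) (zmono n e z) = 0.

Lemma annihilatedP h :
  annihilated h <-> L2 h /\ forall n e, L2dot h (zmono n e) = 0.
Proof.
split=> -[L2h hn]; split => // n e; last by rewrite -Re_L2dot hn.
rewrite /L2dot /cintegral; congr (_ +i* _); first exact: hn.
transitivity (\int[m]_z rdot (h z) (zmono n ('i%C *: e) z)); last exact: hn.
by apply: eq_Rintegral => z _; rewrite Im_hdot /zmono scalerA mulrC -scalerA.
Qed.

Lemma annihilatedD g h : annihilated g -> annihilated h -> annihilated (g + h).
Proof.
move=> /annihilatedP[L2g g0] /annihilatedP[L2h h0]; apply/annihilatedP.
split=> [|n e]; first exact: L2D.
by rewrite (L2dotDl sepE)// ?g0 ?h0 ?addr0//; exact: L2_zmono.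
Qed.

Lemma annihilatedZ c h : annihilated h -> annihilated (c *: h).
Proof.
move=> /annihilatedP[L2h h0]; apply/annihilatedP.
split=> [|n e]; first exact: L2Z.
by rewrite (L2dotZl sepE)// ?h0 ?mulr0//; exact: L2_zmono.
Qed.

(** Multiplication by z^k only shifts the degree of the test monomials. This is where all integer
    degrees, positive and negative, are needed. *)
Lemma annihilated_zexp k h : annihilated h ->
  annihilated (fun z => cval z ^ k *: h z).
Proof.
move=> /annihilatedP[L2h h0]; apply/annihilatedP.
split=> [|n e]; first exact: L2_zexp.
rewrite L2dot_zmono -[RHS](h0 (n - k) e) L2dot_zmono.
apply: eq_cintegral => z; rewrite hdotZl mulrA -expfzDr ?cval_neq0//.
by rewrite opprB addrC.
Qed.

Definition rmul a h : circle R -> E := fun z => (a z)%:C%C *: h z.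

Definition multiplier a := [/\ measurable_fun setT a, exists M, forall z, `|a z|
  <= M &
  forall h, annihilated h -> annihilated (rmul a h)].

Lemma multiplier_cst c : multiplier (fun=> c).
Proof.
split; [exact: measurable_cst|by exists (`|c|)|move=> h Ah].
exact: (@annihilatedZ c%:C%C).
Qed.

Lemma multiplierD a b : multiplier a -> multiplier b -> multiplier (a \+ b).
Proof.
move=> [ma [M aM] Aa] [mb [N bN] Ab]; split.
- exact: measurable_funD.
- by exists (M + N) => z; rewrite (le_trans (ler_normD _ _))// lerD.
- move=> h Ah; rewrite (_ : rmul _ _ = rmul a h + rmul b h).
    by apply: annihilatedD; [exact: Aa|exact: Ab].
  by apply/funext => z; rewrite /rmul /= rmorphD scalerDl.
Qed.

Lemma multiplierM a b : multiplier a -> multiplier b -> multiplier (a \* b).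
Proof.
move=> [ma [M aM] Aa] [mb [N bN] Ab]; split.
- exact: measurable_funM.
- by exists (M * N) => z; rewrite normrM ler_pM.
- move=> h Ah; rewrite (_ : rmul _ _ = rmul a (rmul b h)).
    by apply: Aa; exact: Ab.
  by apply/funext => z; rewrite /rmul /= rmorphM scalerA.
Qed.

(** Dominated convergence for each monomial, with majorant M |<h, z^n e>|, integrable since both
    factors are in [L2]. *)
Lemma multiplier_cvg (a_ : nat -> circle R -> R) a (M : R) :
  (forall n, multiplier (a_ n)) -> (forall n z, `|a_ n z| <= M) ->
  (forall z, a_ n z @[n --> \oo] --> a z) -> multiplier a.
Proof.
move=> ma aM aa.
have mA : measurable_fun setT a.
  by apply: (measurable_fun_cvg (h := a_)) => [n|z _];
    [have [] := ma n|exact: aa].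
have bA z : `|a z| <= M.
  have cn : `|a_ n z| @[n --> \oo] --> `|a z| by apply: cvg_norm; exact: aa.
  rewrite -(cvg_lim _ cn)//; apply: limr_le; last exact: nearW.
  by apply/cvg_ex; exists (`|a z|).
split => //; first by exists M.
move=> h Ah; have [L2h h0] := Ah.
have M0 : 0 <= M by exact: le_trans (bA point).
have L2ah : L2 (rmul a h).
  apply: (@L2M _ _ sepE _ (M ^+ 2)) => //.
  by move=> z; have := bA z; rewrite ler_norml /sqc /= expr0n addr0 => /andP[?
    ?]; nra.
split => // n e.
pose u z := rdot (h z) (zmono n e z).
have iu : m.-integrable setT (fun z => (u z)%:E).
  by apply: L2_intdot => //; exact: L2_zmono.
have mu : measurable_fun setT u by have /measurable_EFinP := measurable_int m
  iu.
have E0 k : \int[m]_z (a_ k z * u z) = 0.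
  have [_ _ /(_ h Ah)[_ /(_ n e) <-]] := ma k.
  by apply: eq_Rintegral => z _; rewrite /rmul rdotZRl.
have iMu : m.-integrable setT (fun z => (M * `|u z|)%:E).
  by apply: RintegrableZ; exact: (integrable_abse iu).
have mau k : measurable_fun setT (fun z => a_ k z * u z).
  by apply: measurable_funM => //; have [] := ma k.
have leu k z : `|a_ k z * u z| <= M * `|u z| by rewrite normrM ler_wpM2r.
have E1 k : (\int[m]_z (a_ k z * u z)%:E = 0)%E.
  rewrite -[LHS]fineK ?[fine _]E0//; apply: integrable_fin_num => //.
  exact: (le_Rintegrable (mau k) iMu (leu k)).
have [|||||_ _ p] := @dominated_convergence _ _ _ m setT measurableT
   (fun k z => (a_ k z * u z)%:E) (fun z => (a z * u z)%:E) (fun z => (M * `|u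
     z|)%:E).
- by move=> k; apply/measurable_EFinP.
- by apply/measurable_EFinP; exact: measurable_funM.
- apply: aeW => z _; apply/cvg_EFin; first exact: nearW.
  by apply: cvgM; [exact: aa|exact: cvg_cst].
- exact: iMu.
- by apply: aeW => z k _; rewrite /= lee_fin.
transitivity (\int[m]_z (a z * u z)).
  by apply: eq_Rintegral => z _; rewrite /rmul rdotZRl.
rewrite /Rintegral; suff -> : (\int[m]_z (a z * u z)%:E = 0)%E by [].
apply: (cvg_unique _ p) => //; rewrite (_ : [sequence _]_n = (fun=> 0%E)).
  exact: cvg_cst.
by apply/funext => k; exact: E1.
Qed.

Lemma multiplierZ c a : multiplier a -> multiplier (fun z => c * a z).
Proof. by move=> ma; exact: (multiplierM (multiplier_cst c) ma). Qed.

Lemma norm_cval_ReIm (z : circle R) :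
  `|complex.Re (cval z)| <= 1 /\ `|complex.Im (cval z)| <= 1.
Proof.
have := sqc_cval z; rewrite /sqc => h; rewrite !ler_norml.
by split; apply/andP; split; nra.
Qed.

(** On the circle Re z = (z + z^-1) / 2, and in the next lemma Im z = i (z^-1 - z) / 2, so both are
    combinations of powers of z. *)
Lemma multiplier_Re : multiplier (fun z => complex.Re (cval z)).
Proof.
split; [by have [] := cmeasurable_cval R|by exists 1 => z;
  have [] := norm_cval_ReIm z|].
move=> h Ah; rewrite (_ : rmul _ _ = 2^-1 *: ((fun z => cval z ^ 1 *: h z) +
    (fun z => cval z ^ (-1) *: h z))).
  by apply/annihilatedZ/annihilatedD; exact: annihilated_zexp.
apply/funext => z; rewrite /rmul.
rewrite -[RHS]/(2^-1 *: (cval z ^ 1 *: h z + cval z ^ (-1) *: h z)).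
rewrite -scalerDl scalerA expr1z exprN1 -cval_conj; congr (_ *: _).
by rewrite ReJ_add mulrC.
Qed.

Lemma multiplier_Im : multiplier (fun z => complex.Im (cval z)).
Proof.
split; [by have [] := cmeasurable_cval R|by exists 1 => z;
  have [] := norm_cval_ReIm z|].
move=> h Ah; rewrite (_ : rmul _ _ = ('i%C / 2) *: ((fun z => cval z ^ (-1) *:
  h z) +
    (- 1) *: (fun z => cval z ^ 1 *: h z))).
  by apply/annihilatedZ/annihilatedD; [|apply/annihilatedZ];
    exact: annihilated_zexp.
apply/funext => z; rewrite /rmul.
rewrite -[RHS]/(('i%C / 2) *: (cval z ^ (-1) *: h z + -1 *: (cval z ^ 1 *:
  h z))).
rewrite scalerA -scalerDl scalerA expr1z exprN1 -cval_conj; congr (_ *: _).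
by rewrite ImJ_sub mulN1r -mulrA mulrC [2^-1 * _]mulrC.
Qed.

Lemma multiplier_sg a : multiplier a -> multiplier (fun z => Num.sg (a z)).
Proof.
move=> ma; have [_ [M aM] _] := ma.
have M0 : 0 <= M by exact: le_trans (aM point).
(* Rescaling into [-1, 1], where the iteration converges, without changing the sign; the added 1
   covers M = 0. *)
pose c := (M + 1)^-1; have c0 : 0 < c by rewrite invr_gt0; lra.
have ca z : -1 <= c * a z <= 1.
  rewrite -ler_norml normrM (gtr0_norm c0) mulrC ler_pdivrMr; last lra.
  by rewrite mul1r (le_trans (aM z))// lerDl.
apply: (@multiplier_cvg (fun n z => iter n (@sgstep R) (c * a z)) _ 1).
- elim=> [|n ih] /=; first exact: multiplierZ.
  rewrite (_ : (fun z => _) = (fun z => 3 / 2 * iter n (@sgstep R) (c * a z) +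
    (- (1 / 2)) * (iter n (@sgstep R) (c * a z) * (iter n (@sgstep R) (c * a z)
      * iter n (@sgstep R) (c * a z))))).
    apply: multiplierD; first exact: multiplierZ.
    by apply: multiplierZ; apply: multiplierM => //; exact: multiplierM.
  by apply/funext => z; rewrite {1}/sgstep; field.
- by move=> n z; rewrite ler_norml; exact: iter_sgstep_itv.
- move=> z; rewrite (_ : Num.sg (a z) = Num.sg (c * a z)).
    exact: iter_sgstep_cvg.
  by rewrite sgrM (gtr0_sg c0) mul1r.
Qed.

Lemma multiplier_gt0 a : multiplier a -> multiplier \1_[set z | 0 < a z].
Proof.
move=> /multiplier_sg ms.
rewrite (_ : \1__ = (fun z => 2^-1 * (Num.sg (a z) * Num.sg (a z) +
  Num.sg (a z)))).
  by apply: multiplierZ; apply: multiplierD => //; exact: multiplierM.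
apply/funext => z; rewrite indicE; case: (sgrP (a z)) => az.
- by rewrite memNset/= ?az ?ltxx// mulr0 addr0 mulr0.
- rewrite mem_set//=; lra.
- rewrite memNset/=; [lra|by apply/negP; rewrite -leNgt ltW].
Qed.

Definition multiplier_sets : set (set (circle R)) := [set A | multiplier \1_A].

Lemma multiplier_sigma_algebra : sigma_algebra setT multiplier_sets.
Proof.
have mC A : multiplier \1_A -> multiplier \1_(~` A).
  move=> mA; rewrite (_ : \1__ = (fun z => 1 + (-1) * \1_A z)).
    by apply: multiplierD; [exact: multiplier_cst|exact: multiplierZ].
  apply/funext => z; rewrite !indicE in_setC; case: (z \in A) => /=; lra.
have mU A B : multiplier \1_A -> multiplier \1_B -> multiplier \1_(A `|` B).
  move=> mA mB; rewrite -(setCK (A `|` B)) setCU; apply: (mC _).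
  rewrite (_ : \1__ = (fun z => \1_(~` A) z * \1_(~` B) z)).
    by apply: multiplierM; exact: mC.
  by apply/funext => z; rewrite !indicE in_setI -natrM mulnb.
have m0 : multiplier \1_(set0 : set (circle R)).
  rewrite (_ : \1__ = fun=> 0); first exact: multiplier_cst.
  by apply/funext => z; rewrite indicE in_set0.
split => // [A mA|A mA]; first by rewrite setTD; exact: (mC A mA).
have mbig n : multiplier \1_(\big[setU/set0]_(i < n) A i).
  elim: n => [|n ih]; first by rewrite big_ord0.
  by rewrite big_ord_recr/=; exact: (mU _ _ ih (mA n)).
apply: (multiplier_cvg (M := 1) mbig).
  by move=> n z; rewrite indicE; case: (_ \in _); rewrite ?normr1 ?normr0.
move=> z; have [[k _ Akz]|nA] := pselect ((\bigcup_k A k) z).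
  apply: (@cvg_near_cst _ _ _ _ _ _); exists k.+1 => // n /= kn.
  rewrite !indicE !mem_set//; first by exists k.
  by rewrite -bigcup_mkord; exists k.
rewrite (_ : (fun n => _) = fun=> \1_(\bigcup_k A k) z); first exact: cvg_cst.
apply/funext => n; rewrite !indicE !memNset// -bigcup_mkord => -[k kn Akz].
by apply: nA; exists k.
Qed.

(* [multiplier_sets] is a sigma-algebra, hence a measurable structure on the
   circle for which it is enough that [Re z] and [Im z] be measurable. *)
Local Notation MT := (g_sigma_algebraType multiplier_sets).

Lemma measurable_MTE : @measurable _ MT = multiplier_sets.
Proof.
apply/seteqP; split=> [A|A mA]; last exact: sub_sigma_algebra.
by apply: smallest_sub => //; exact: multiplier_sigma_algebra.
Qed.

Lemma measurable_MT_multiplier a : multiplier a ->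
  measurable_fun setT (a : MT -> R).
Proof.
move=> ma; apply: measurable_fun_gtP => c; rewrite measurable_MTE.
rewrite (_ : [set z | c < a z] = [set z | 0 < (a z + - c)]).
  by apply: multiplier_gt0; apply: multiplierD => //; exact: multiplier_cst.
by apply/seteqP; split=> z /=; rewrite subr_gt0.
Qed.

(** The pieces are discs with rational centre, written through Re z and Im z alone, so they are
    measurable for any structure making these two functions measurable. Discs not contained in [U]
    are replaced by the empty set. *)
Lemma circle_open_bigcup (U : set R[i]) : @open (R[i]^o) U ->
  @cval R @^-1` U = \bigcup_(i : rat * rat * nat)
   (if `[< forall w, sqc (w - (ratr i.1.1 +i* ratr i.1.2)) < i.2.+1%:R^-1 ->
     U w >]
    then [set z : circle R | (complex.Re (cval z) - ratr i.1.1) ^+ 2 +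
      (complex.Im (cval z) - ratr i.1.2) ^+ 2 < i.2.+1%:R^-1] else set0).
Proof.
move=> oU; apply/seteqP; split=> [z Uz|z [[[p q] n] _ /=]]; last first.
  case: asboolP => // H /= h; apply: H; rewrite /sqc.
  by case: (cval z) h.
have /nbhs_ballP[[e e'] /=] : nbhs (cval z : R[i]^o) U by exact: open_nbhs_nbhs.
rewrite ltcE /= => /andP[/eqP-> e0] eU.
(* Here 1 / (n + 1) is a squared radius: two points of the disc are at squared distance below 4 / (n
   + 1) < e^2. Each coordinate of the centre is approximated with half of it. *)
have e2 : 0 < e ^+ 2 / 4 by rewrite divr_gt0// exprn_gt0.
have [n] := ltr_add_invr e2; rewrite add0r => ne.
have n0 : 0 < n.+1%:R^-1 / 2 :> R by rewrite divr_gt0// invr_gt0.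
have close (x : R) : exists p : rat, (x - ratr p) ^+ 2 < n.+1%:R^-1 / 2.
  have s0 : 0 < Num.sqrt (n.+1%:R^-1 / 2) :> R by rewrite sqrtr_gt0.
  have : x - Num.sqrt (n.+1%:R^-1 / 2) < x by rewrite ltrBlDr ltrDl.
  move=> /rat_in_itvoo[p]; rewrite in_itv /= => /andP[p1 p2]; exists p.
  have := sqr_sqrtr (ltW n0); move: (Num.sqrt _) s0 p1 => s s0 p1 <-.
  by rewrite ltr_pXn2r ?nnegrE ?(ltW s0)//;
    [rewrite ltrBlDr addrC -ltrBlDr|rewrite subr_ge0 ltW].
have [p zp] := close (complex.Re (cval z)).
have [q zq] := close (complex.Im (cval z)).
exists (p, q, n) => //=; rewrite asboolT /=.
  by move: (_ ^+ 2) (_ ^+ 2) zp zq => x y zp zq; rewrite [ltRHS]splitr ltrD.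
move=> w wn; apply: eU; rewrite -ball_normE /ball_ /= normc_def ltcR.
rewrite -[ltRHS](ger0_norm (ltW e0)) -sqrtr_sqr ltr_sqrt ?exprn_gt0//.
move: zp zq wn; rewrite /sqc; case: (cval z) w => z1 z2 [w1 w2] /= zp zq wn.
have h1 := sqr_ge0 (z1 - ratr p + (w1 - ratr p)).
have h2 := sqr_ge0 (z2 - ratr q + (w2 - ratr q)).
set N := n.+1%:R^-1 in zp zq wn ne *.
have : (z1 - w1) ^+ 2 <= 2 * (z1 - ratr p) ^+ 2 + 2 * (w1 - ratr p) ^+ 2 by nra.
have : (z2 - w2) ^+ 2 <= 2 * (z2 - ratr q) ^+ 2 + 2 * (w2 - ratr q) ^+ 2 by nra.
move: zp zq wn ne.
move: ((z1 - ratr p) ^+ 2) ((z2 - ratr q) ^+ 2) => a1 a2.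
move: ((w1 - ratr p) ^+ 2) ((w2 - ratr q) ^+ 2) => b1 b2.
move: ((z1 - w1) ^+ 2) ((z2 - w2) ^+ 2) => c1 c2; lra.
Qed.

Lemma multiplier_indic (A : set (circle R)) : measurable A -> multiplier \1_A.
Proof.
move=> mA; rewrite -[multiplier _]/(multiplier_sets A).
apply: (smallest_sub multiplier_sigma_algebra _ mA).
move=> _ [U oU <-]; rewrite -measurable_MTE circle_open_bigcup//.
apply: countable_bigcupT_measurable => // -[[p q] n]; case: asboolP => _ //=.
apply: (@measurable_lt_set _ MT) => //.
by apply: measurable_funD; apply: measurable_funX; apply: measurable_funB => //;
  apply: measurable_MT_multiplier; [exact: multiplier_Re|exact: multiplier_Im].
Qed.

(** By [rdot_leP] with bound 0, h vanishes outside the union of the sets [A n]. On [A n] the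
    function Re <h, d n> is positive, yet its integral over [A n] is 0, as seen by testing the
    cut-off of h against the constant monomial [d n]; so [A n] is null. *)
Lemma annihilated_eq0 h : annihilated h -> nsq h = 0.
Proof.
move=> Ah; have [L2h _] := Ah.
have [d dP] := separable_approx_seq sepE.
pose A n := [set z | rdot (d n) (d n) < 2 * rdot (h z) (d n)].
have mA n : measurable (A n).
  by apply: measurable_lt_set => //; apply: measurable_funM => //;
    exact: L2_meas.
have A0 n : m (A n) = 0.
  have [_ _ /(_ h Ah)[L2Ah /(_ 0 (d n)) int0]] := multiplier_indic (mA n).
  pose u z := \1_(A n) z * rdot (h z) (d n).
  have u0 z : 0 <= u z.
    rewrite /u indicE; case: (boolP (z \in A n)); last by rewrite mul0r.
    by move=> /set_mem; rewrite /A /= => h1; rewrite mul1r;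
      have := rdot_ge0 (d n); lra.
  have iu : m.-integrable setT (fun z => (u z)%:E).
    have := L2_intdot sepE L2Ah (L2_cst sepE (d n)).
    by apply: eq_integrable => // z _; rewrite /rmul rdotZRl.
  have : (\int[m]_z `|(u z)%:E| = 0)%E.
    under eq_integral do rewrite gee0_abs ?lee_fin//.
    rewrite -[LHS]fineK; last exact: integrable_fin_num.
    congr (_%:E); rewrite -[RHS]int0; apply: eq_Rintegral => z _.
    by rewrite /rmul /zmono expr0z scale1r rdotZRl.
  move=> /(ae_eq_integral_abs _ measurableT (measurable_int _ iu)) [N [mN N0
    uN]].
  apply: (subset_measure0 (mA n) mN _ N0) => z Az; apply: uN => /= /(_ I).
  rewrite /u indicE mem_set// mul1r => -[]; move: Az; rewrite /A /= => Az h0.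
  by move: Az; rewrite h0 mulr0 ltNge rdot_ge0.
have mU : measurable (\bigcup_n A n) by exact: bigcupT_measurable.
have U0 : m (\bigcup_n A n) = 0.
  apply/eqP; rewrite eq_le measure_ge0 andbT.
  apply: le_trans (measure_sigma_subadditive _ mA mU _) _ => //.
  by rewrite eseries0// => n _ _; exact: A0.
rewrite /nsq /Rintegral (@ge0_negligible_integral _ _ _ m setT (\bigcup_n A
  n))//.
- rewrite (@eq_integral _ _ _ m _ (fun=> 0%E)) ?integral0// => z.
  rewrite inE => -[_ nA]; congr (_%:E); apply/eqP.
  rewrite eq_le rdot_ge0 andbT; apply/(rdot_leP dP) => n.
  rewrite subr_le0 leNgt; apply/negP => h1; apply: nA; by exists n.
- by apply/measurable_EFinP; exact: L2_measr.
- by move=> z _; rewrite lee_fin rdot_ge0.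
Qed.

(** With |h| = 0 the inequality 2t Re <h, g> <= |h|^2 + t^2 |g|^2 has no constant term, and
    [quadratic_eq0] applies to g = f and g = if. *)
Lemma L2dot_nsq0 f h : L2 f -> L2 h -> nsq h = 0 -> L2dot h f = 0.
Proof.
move=> L2f L2h h0.
have key g : L2 g -> complex.Re (L2dot h g) = 0.
  move=> L2g; apply: (quadratic_eq0 (nsq_ge0 g)) => t.
  have n0 : nsq (0 : circle R -> E) = 0 by rewrite /nsq -Re_L2dot L2dot0l.
  have := @redot_amgm _ E E sepE sepE (h, 0) (g, 0) t.
  rewrite /redot (_ : sumdot _ _ = L2dot h g);
    last by rewrite /sumdot L2dot0r addr0.
  have nE (k : circle R -> E) : nrm2 (k, (0 : circle R -> E)) = nsq k.
    by rewrite /nrm2 /= n0 addr0.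
  rewrite !nE h0 add0r.
  by apply; split => //; exact: L20.
have h1 := key f L2f; have h2 := key _ (L2Z sepE 'i%C L2f).
apply/eqP; rewrite eq_complex h1 eqxx /=; apply/eqP; rewrite -[RHS]h2.
by apply: eq_Rintegral => z _; rewrite Im_hdot.
Qed.

End totality.

(** * The reflection J1 *)

Section reflection.
Variables (R : realType) (E : hilbertType R).
Hypothesis sepE : separable E.
Local Notation m := (@circle_prob R).
Local Notation L2 := (@L2 R E).
Local Notation H2 := (@hardy R E).
Implicit Types (f g h : circle R -> E).

Lemma circle_conjK : involutive (@circle_conj R).
Proof. by move=> z; apply: val_inj; rewrite /= conjcK. Qed.

Lemma J1K f : J1 (J1 f) = f.
Proof. by apply/funext => z; rewrite /J1 circle_conjK. Qed.

Lemma L2_J1 f : L2 f -> L2 (J1 f).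
Proof.
move=> L2f; apply: (L2I sepE) => [e|].
  exact: (measurableT_comp (L2_meas L2f e) (@measurable_circle_conj R)).
exact: (Rintegrable_circle_conj (L2_intsq sepE L2f)).
Qed.

Lemma L2dot_J1 f g : L2 f -> L2 g -> L2dot (J1 f) (J1 g) = L2dot f g.
Proof.
move=> L2f L2g.
exact: (cintegral_circle_conj (L2_cint sepE L2f L2g)).
Qed.

Lemma J1_zmono n (e : E) : J1 (@zmono R E n e) = zmono (- n) e.
Proof.
by apply/funext => z; rewrite /J1 /zmono cval_circle_conj exprz_inv.
Qed.

Lemma L2dot_zshift_J1 f g : L2dot (zshift f) (J1 g) = L2dot f (J1 (zshift g)).
Proof.
rewrite L2dot_zshift_adj; congr L2dot; apply/funext => z.
by rewrite /J1 /zshift exprN1 cval_circle_conj.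
Qed.

Lemma zmono_orthogonal (k n : int) (e e' : E) : n < k ->
  L2dot (@zmono R E k e) (zmono n e') = 0.
Proof.
move=> nk; rewrite L2dot_zmono.
have [j j0 kn] : exists2 j : nat, (0 < j)%N & k - n =
  Posz j by exists `|k - n|%N; lia.
rewrite (@eq_cintegral _ _ (fun z => hdot e e' * cval z ^+ j)); last first.
  move=> z; rewrite hdotZl mulrA -expfzDr ?cval_neq0// mulrC; congr (_ * _).
  by rewrite exprnP -kn addrC.
by rewrite cintegralZ ?cintegral_zexp ?mulr0//; exact: cintegrable_zexp.
Qed.

Lemma hardy_zmono (n : int) (e : E) : 0 <= n -> H2 (zmono n e).
Proof.
move=> n0; apply/hardyP; split=> [|k k0 e']; first exact: L2_zmono.
by apply: zmono_orthogonal; exact: lt_le_trans k0 n0.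
Qed.

(* [J1 g] is orthogonal to [z^n e] for n > 0, so its projection onto
   [A = {f | f _|_ z^n e for all n <= 0}] is orthogonal to every [z^n e]. *)
Lemma zshift_hardy_orth_J1 f g : H2 f -> H2 g -> L2dot (zshift f) (J1 g) = 0.
Proof.
move=> H2f H2g; have L2f := hardy_L2 H2f; have L2g := hardy_L2 H2g.
have L2Jg := L2_J1 L2g; have L2zf := L2_zshift sepE L2f.
pose A := [set a : circle R -> E | L2 a /\
  forall n : int, n <= 0 -> forall e, L2dot a (zmono n e) = 0].
have Azmono n e : 0 < n -> A (zmono n e).
  move=> n0; split=> [|k k0 e']; first exact: L2_zmono.
  by apply: zmono_orthogonal; exact: le_lt_trans k0 n0.
have Azf : A (zshift f).
  split=> // n n0 e; have -> : zmono n e = zshift (@zmono R E (n - 1) e).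
    by rewrite zshift_zmono addrC subrK.
  by rewrite L2dot_zshift; have /hardyP[_] := H2f; apply; lia.
have cA : is_closed_subspace (L2 `*` L2) (A `*` L2).
  pose M : set ((circle R -> E) * (circle R -> E)) :=
    [set q | exists (n : int) e, n <= 0 /\ q = (zmono n e, 0)].
  rewrite (_ : A `*` L2 = ominus (L2 `*` L2) M).
    apply: (ominus_closed sepE sepE) => [|_ [n [e [_ ->]]]].
      exact: L2pair_closed.
    by split; [exact: L2_zmono|exact: L20].
  apply/seteqP; split=> [x [[x1 xn] x2]|x [[x1 x2] xM]].
    by split => // _ [n [e [n0 ->]]]; rewrite /sumdot /= L2dot0r addr0 xn.
  split => //; split => // n n0 e.
  have := xM (zmono n e, 0); rewrite /sumdot /= L2dot0r addr0; apply.
  by exists n, e.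
have [|[y1 y2] [[L2y1 Ay1] L2y2] yP] := projection sepE sepE cA (x := (J1 g,
  0)).
  by split => //; exact: L20.
have y1P a : A a -> L2dot (J1 g) a = L2dot y1 a.
  move=> Aa; have [L2a _] := Aa.
  have := yP (a, 0); rewrite /sumdot /= L2dot0r addr0 (L2dotBl sepE)//.
  by move=> /(_ _)/subr0_eq; apply; split => //; exact: L20.
have y10 : nsq y1 = 0.
  apply: (annihilated_eq0 sepE); apply/annihilatedP; split=> // n e.
  have [n0|n0] := leP n 0; first exact: Ay1.
  rewrite -y1P; last exact: Azmono.
  (* Reflection turns degree n > 0 into degree -n < 0, where the coefficients of [g] vanish. *)
  rewrite -(opprK n) -J1_zmono L2dot_J1//; last exact: L2_zmono.
  by have /hardyP[_] := H2g; apply; rewrite oppr_lt0.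
(* As [zshift f] lies in [A], the projection [y1], which has norm 0, may replace [J1 g]. *)
rewrite (L2dotC sepE)// y1P// (L2dot_nsq0 sepE)// rmorph0//.
Qed.

End reflection.

(** * Reflection, adjointness and double complements on the direct sum *)

Section pairs.
Variables (R : realType) (E F : hilbertType R).
Hypotheses (sepE : separable E) (sepF : separable F).
Local Notation V := ((circle R -> E) * (circle R -> F))%type.
Local Notation D := (@L2 R E `*` @L2 R F).
Local Notation K := (@L2 R E `*` @hardy R F).
Local Notation HH := (@hardy R E `*` @hardy R F).
Local Notation J := (@J2 R E F).
Local Notation X :=
  (opsum (@zshift R E) (adjoint_on (@hardy R F) (@zshift R F))).
Local Notation MM := (opsum (@zshift R E) (@zshift R F)).
Implicit Types (p q x y : V) (N M : set V).

Lemma J2K p : J (J p) = p.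
Proof. by case: p => p1 p2; rewrite /J2 /opsum /= J1K. Qed.

Lemma L2_hardy_L2 p : K p -> D p.
Proof. by move=> [p1 /hardy_L2]. Qed.

Lemma hardy_hardy_L2_hardy p : HH p -> K p.
Proof. by move=> [/hardy_L2]. Qed.

Lemma J2_L2_hardy p : K p -> K (J p).
Proof. by move=> [p1 p2]; split => //; exact: L2_J1. Qed.

Lemma sumdot_J2 p q : D p -> D q -> sumdot (J p) q = sumdot p (J q).
Proof.
move=> [p1 p2] [q1 q2]; rewrite /sumdot; congr (_ + _).
by rewrite -[q.1 in LHS]J1K L2dot_J1//; exact: L2_J1.
Qed.

(** [J2] is a self-adjoint involution preserving [K], so it commutes with taking complements in [K].
    This makes the two formulas for N in the theorem equivalent. *)
Lemma J2_ominus M : M `<=` K -> J @` ominus K M = ominus K (J @` M).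
Proof.
move=> MK; apply/seteqP; split=> [_ [p [Kp pM] <-]|p [Kp pM]].
  split=> [|_ [q Mq <-]]; first exact: J2_L2_hardy.
  rewrite sumdot_J2 ?J2K ?pM//; first exact: L2_hardy_L2.
  by apply/L2_hardy_L2/J2_L2_hardy/MK.
exists (J p); last exact: J2K.
split=> [|q Mq]; first exact: J2_L2_hardy.
rewrite sumdot_J2; [|exact: L2_hardy_L2|by apply/L2_hardy_L2/MK].
by apply: pM; exists q.
Qed.

Lemma hardy_hardy_X p : HH p -> HH (X p).
Proof.
move=> [p1 p2]; split; first exact: hardy_zshift.
by have [] := adjoint_zshift sepF p2.
Qed.

Lemma L2_hardy_MM p : K p -> K (MM p).
Proof. by move=> [p1 p2]; split; [exact: L2_zshift|exact: hardy_zshift]. Qed.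

Lemma sumdot_MM_J2 p q : K p -> HH q -> sumdot (MM p) (J q) =
  sumdot p (J (X q)).
Proof.
move=> [p1 p2] [q1 q2]; rewrite /sumdot; congr (_ + _).
  exact: L2dot_zshift_J1.
by have [_] := adjoint_zshift sepF q2; exact.
Qed.

(** If [y] is the projection on [N] of a point [p] of the double complement, then p - y lies in the
    complement of [N] and is orthogonal to both [p] and [y], hence has norm 0. *)
Lemma ominusK N : is_closed_subspace D N -> N `<=` K ->
  ominus K (ominus K N) = N.
Proof.
move=> cN NK; apply/seteqP; split=> [p [Kp pN]|p Np]; last first.
  split=> [|q [Kq qN]]; first exact: NK.
  rewrite (sumdotC sepE sepF) ?qN ?rmorph0//; first by apply/L2_hardy_L2/NK.
  exact: L2_hardy_L2.
have Dp := L2_hardy_L2 Kp.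
have [y Ny yP] := projection sepE sepF cN Dp.
have Dy := L2_hardy_L2 (NK _ Ny).
have cK := L2_hardy_closed sepE sepF.
have Kpy : K (p - y).
  rewrite -scaleN1r; apply: (closed_add cK) => //.
  by apply: (closed_scale _ cK); exact: NK.
have Dpy := L2_hardy_L2 Kpy.
have pyN : ominus K N (p - y) by split.
have n0 : nrm2 (p - y) = 0.
  apply/(@complexI R); rewrite -sumdot_nrm2 (sumdotBl sepE sepF)// pN//.
  by rewrite (sumdotC sepE sepF)// yP// rmorph0 subr0.
(* Norm 0 does not make the functions [p] and [y] equal; the constant sequence [y] converges to [p],
   and closedness of [N] concludes. *)
apply: (closed_tends cN (u := fun=> y)) => // e e0.
apply: nearW => n; rewrite -opprB nrm2N// n0; exact: ltW.
Qed.

End pairs.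

Theorem theorem3p4 (R : realType) (E F : hilbertType R)
    (sepE : separable E) (sepF : separable F) :
  let L2E := @L2 R E in let H2E := @hardy R E in
  let L2F := @L2 R F in let H2F := @hardy R F in
  let X := opsum (@zshift R E) (adjoint_on H2F (@zshift R F)) in
  let MM := opsum (@zshift R E) (@zshift R F) in
  let J := @J2 R E F in
  let star (N3 : set ((circle R -> E) * (circle R -> F))) :=
    [set (zshift f, 0) | f in H2E] `<=` N3 /\ N3 `<=` L2E `*` H2F in
  (forall N, invariant_subspace (H2E `*` H2F) X N ->
     exists N3, [/\ invariant_subspace (L2E `*` L2F) MM N3,
       N = J @` ominus (L2E `*` H2F) N3,
       N = ominus (L2E `*` H2F) (J @` N3) &
       star N3]) /\
  (forall N3, invariant_subspace (L2E `*` L2F) MM N3 -> star N3 ->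
     invariant_subspace (H2E `*` H2F) X (J @` ominus (L2E `*` H2F) N3)).
Proof.
move=> L2E H2E L2F H2F X MM J star.
have cK : is_closed_subspace (L2E `*` L2F) (L2E `*` H2F).
  exact: L2_hardy_closed.
have KD p : (L2E `*` H2F) p -> (L2E `*` L2F) p by exact: L2_hardy_L2.
split=> [N [cN XN]|N3 [cN3 MN3] [zN3 N3K]].
- have NH : N `<=` H2E `*` H2F by case: cN.
  have NK : N `<=` L2E `*` H2F by move=> p /NH; exact: hardy_hardy_L2_hardy.
  have cDN : is_closed_subspace (L2E `*` L2F) N.
    by apply: closed_trans cN; exact: hardy_hardy_closed.
  have JNK : J @` N `<=` L2E `*` H2F.
    by move=> _ [p Np <-]; apply: J2_L2_hardy => //; exact: NK.
  pose N3 := ominus (L2E `*` H2F) (J @` N).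
  have N3K : N3 `<=` L2E `*` H2F by move=> p [].
  have NJN3 : N = ominus (L2E `*` H2F) (J @` N3).
    (* [J2] moves inside the complement and cancels against the one in [N3]; the double complement
       then returns [N]. *)
    rewrite /N3 J2_ominus// (_ : J @` (J @` N) = N) ?ominusK//.
    apply/seteqP; split=> [_ [_ [p Np <-] <-]|p Np]; first by rewrite /J J2K.
    by exists (J p); [exists p|exact: J2K].
  exists N3; split => //; last 1 first.
  + split => // _ [f H2f <-]; split.
      by split; [exact/L2_zshift/hardy_L2|exact: hardy0].
    move=> _ [q Nq <-]; have [H2q _] := NH _ Nq.
    by rewrite /sumdot /= L2dot0l addr0 zshift_hardy_orth_J1.
  + split.
      apply: (closed_trans cK); apply: (ominus_closed sepE sepF cK) => p /JNK.
      exact: KD.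
    move=> p [Kp pJN]; split; first exact: L2_hardy_MM.
    move=> _ [q Nq <-]; rewrite sumdot_MM_J2//; last exact: NH.
    by apply: pJN; exists (X q) => //; exact: XN.
  + by rewrite J2_ominus.
- have N3D : N3 `<=` L2E `*` L2F by move=> p /N3K; exact: KD.
  have JN3D : J @` N3 `<=` L2E `*` L2F.
    by move=> _ [p /N3K Kp <-]; apply: KD; exact: J2_L2_hardy.
  rewrite J2_ominus//.
  have subH : ominus (L2E `*` H2F) (J @` N3) `<=` H2E `*` H2F.
    move=> p [[p1 p2] pN3]; split => //; apply/hardyP; split=> // n n0 e.
    (* For n < 0 the monomial of degree -n is z times one of degree -n - 1 >= 0, so it lies in z
       H2E. Its reflection has degree n, so orthogonality to it is the Hardy condition on [p.1]. *)
    have : N3 (zmono (- n) e, 0).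
      apply: zN3; exists (zmono (- n - 1) e).
        by apply: hardy_zmono => //; lia.
      by rewrite zshift_zmono addrC subrK.
    move=> N3z; have := pN3 (J (zmono (- n) e, 0)).
    rewrite /sumdot /= L2dot0r addr0 J1_zmono opprK; apply.
    by exists (zmono (- n) e, 0).
  split.
    have [_ K0 lK clK] := ominus_closed sepE sepF cK JN3D.
    split => // u p uN Hp up; apply: clK uN _ up.
    exact: hardy_hardy_L2_hardy.
  move=> p Np; have HHp := subH _ Np; split.
    by apply: hardy_hardy_L2_hardy; exact: hardy_hardy_X.
  move=> _ [q N3q <-]; have Kq := N3K _ N3q.
  have HX := hardy_hardy_X sepE sepF HHp.
  have KX : (L2E `*` H2F) (X p) by exact: hardy_hardy_L2_hardy.
  have Kp : (L2E `*` H2F) p by exact: hardy_hardy_L2_hardy.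
  have KM : (L2E `*` H2F) (MM q) by exact: L2_hardy_MM.
  have KJq : (L2E `*` H2F) (J q) by exact: J2_L2_hardy.
  have KJM : (L2E `*` H2F) (J (MM q)) by exact: J2_L2_hardy.
  (* The adjointness identity read backwards: <X p, J q> = conj <q, J (X p)> = conj <MM q, J p> =
     <p, J (MM q)>, which is 0 because [MM q] is in [N3]. *)
  rewrite (sumdotC sepE sepF) ?(sumdot_J2 sepE); [|exact: KD..].
  rewrite -(sumdot_MM_J2 sepF)// -(sumdot_J2 sepE); [|exact: KD..].
  rewrite -(sumdotC sepE sepF); [|exact: KD..].
  by case: Np => _; apply; exists (MM q) => //; exact: MN3.
Qed.
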